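(* Let $K$ be a field, let $h\ge 2$ be an integer, and let $B_h$ be the numerical semigroup $$B_h=\langle (2h-1)2h,\ (2h-1)(2h+1),\ 2h(2h+1),\ 2h(2h+1)+2h-1\rangle.$$ Then both algebras $K[B_h]$ and $\mathrm{gr}_{\mathfrak{m}}K[B_h]$ have the Betti sequence $(1,\,4h,\,8h-4,\,4h-3)$.
   Context: $\langle b_1,\dots,b_m\rangle$ denotes the submonoid of $\mathbb{N}=\{0,1,2,\dots\}$ generated by $b_1,\dots,b_m$; a numerical semigroup is a submonoid of $\mathbb{N}$ with finite complement. The four listed integers are the minimal generators of $B_h$. For a numerical semigroup $H$ minimally generated by $b_1,\dots,b_4$, the semigroup ring $K[H]$ is the $K$-subalgebra of the univariate polynomial ring $K[s]$ generated by the monomials $s^u$, $u\in H$. Let $S=K[x,y,z,t]$ and let $I_H$ be the kernel of the $K$-algebra map $S\to K[H]$ with $x\mapsto s^{b_1}$, $y\mapsto s^{b_2}$, $z\mapsto s^{b_3}$, $t\mapsto s^{b_4}$, so $K[H]\cong S/I_H$. The tangent cone is $\mathrm{gr}_{\mathfrak{m}}K[H]=\bigoplus_{i\ge0}\mathfrak{m}^i/\mathfrak{m}^{i+1}$, where $\mathfrak{m}=(s^u: u\in H\setminus\{0\})K[H]$. It is isomorphic to $S/I_H^*$, where $I_H^*=(f^*:0\ne f\in I_H)$ and $f^*$ is the homogeneous component of smallest degree of $f$ with respect to the standard grading of $S$. The $i$-th Betti number of $M=S/I_H$ or $M=S/I_H^*$ is $\beta_i(M)=\dim_K\mathrm{Tor}_i^S(M,K)$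 with $K=S/(x,y,z,t)$, i.e. the rank of the $i$-th free module in the minimal graded free $S$-resolution of $M$. The Betti sequence is $(\beta_0,\beta_1,\beta_2,\dots)$, with the convention that only the entries up to the last nonzero one are listed. *)

(* Defs.v *)
From mathcomp Require Import all_boot all_order all_algebra.
From mathcomp.multinomials Require Export mpoly.
From mathcomp Require Import zify.

Set Implicit Arguments.
Unset Strict Implicit.
Unset Printing Implicit Defensive.

Import GRing.Theory.
Local Open Scope ring_scope.

Section NumericalSemigroups.
Local Open Scope nat_scope.

Definition gen_monoid n (b : 'I_n -> nat) (u : nat) : Prop :=
  exists c : 'I_n -> nat, u = \sum_i c i * b i.

Definition numerical_semigroup (H : nat -> Prop) : Prop :=
  [/\ H 0, forall u v, H u -> H v -> H (u + v)
    & exists N, forall u, N <= u -> H u].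

(* No b i lies in the submonoid generated by the other ones. *)
Definition minimal_generators n (b : 'I_n -> nat) : Prop :=
  forall (i : 'I_n) (c : 'I_n -> nat), c i = 0 -> b i <> \sum_j c j * b j.

Definition Bgen (h : nat) : 4.-tuple nat :=
  [tuple (2 * h - 1) * (2 * h); (2 * h - 1) * (2 * h + 1);
         2 * h * (2 * h + 1); 2 * h * (2 * h + 1) + 2 * h - 1].

Lemma Bgen_numerical h : 2 <= h ->
  numerical_semigroup (gen_monoid (tnth (Bgen h))).
Proof.
case: h => [|[|k]] // _; set h := k.+2; pose H := gen_monoid (tnth (Bgen h)).
have HD u v : H u -> H v -> H (u + v).
  move=> [c ->] [d ->]; exists (fun i => c i + d i).
  by rewrite -big_split; apply: eq_bigr => i _; rewrite mulnDl.
have HM a u : H u -> H (a * u).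
  move=> [c ->]; exists (fun i => a * c i).
  by rewrite big_distrr; apply: eq_bigr => i _; rewrite /= mulnA.
have Hb i : H (tnth (Bgen h) i).
  exists (fun j => j == i); rewrite (bigD1 i) //= eqxx mul1n big1 ?addn0 //.
  by move=> j /negPf ->.
split=> //; first by exists (fun=> 0); rewrite big1.
pose v := h * ((2 * h - 1) * (2 * h)) + (h - 1) * (2 * h * (2 * h + 1)).
have Hv : H v by apply: (HD _ _ (HM _ _ (Hb 0%R)) (HM _ _ (Hb 2%R))).
have e1 : 2 * h - 1 = 2 * k + 3 by rewrite /h; lia.
have e2 : h - 1 = k + 1 by rewrite /h; lia.
have e3 : h = k + 2 by rewrite /h; lia.
have Hv1 : H v.+1.
  have -> : v.+1 = (h + (h - 1)) * ((2 * h - 1) * (2 * h + 1)).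
    by rewrite /v e1 e2 e3; lia.
  exact: (HM _ _ (Hb 1%R)).
have v0 : 0 < v by rewrite /v e1 e2 e3 !addnS.
move: v v0 Hv Hv1 {Hb} => v v0 Hv Hv1.
exists (v * v) => u vu.
have le_rq : u %% v <= u %/ v.
  by apply: (@leq_trans v); [exact/ltnW/ltn_pmod | rewrite leq_divRL].
have -> : u = (u %/ v - u %% v) * v + (u %% v) * v.+1.
  by rewrite mulnS addnCA -mulnDl subnK // addnC -divn_eq.
exact: HD (HM _ _ Hv) (HM _ _ Hv1).
Qed.

Lemma Bgen_minimal h : 2 <= h -> minimal_generators (tnth (Bgen h)).
Proof.
case: h => [|[|k]] // _ i c ci.
pose x := k * k.
have [e0 e1 e2 e3] : [/\ tnth (Bgen k.+2) 0%R = 4 * x + 14 * k + 12,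
    tnth (Bgen k.+2) 1%R = 4 * x + 16 * k + 15,
    tnth (Bgen k.+2) 2%R = 4 * x + 18 * k + 20
  & tnth (Bgen k.+2) 3%R = 4 * x + 20 * k + 23].
  have e : 2 * k.+2 - 1 = 2 * k + 3 by lia.
  rewrite !(tnth_nth 0) /= -[2 * _ * _ + _ - 1]addnBA ?e; last by lia.
  by rewrite /x; split; lia.
have lt2 j l : tnth (Bgen k.+2) j < 2 * tnth (Bgen k.+2) l.
  have P j' : 4 * x + 14 * k + 12 <= tnth (Bgen k.+2) j' <= 4 * x + 20 * k + 23.
    case: j' => [[|[|[|[|//]]]]] lt_j.
    - by rewrite (_ : Ordinal _ = 0%R) ?e0; [lia | apply: val_inj].
    - by rewrite (_ : Ordinal _ = 1%R) ?e1; [lia | apply: val_inj].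
    - by rewrite (_ : Ordinal _ = 2%R) ?e2; [lia | apply: val_inj].
    - by rewrite (_ : Ordinal _ = 3%R) ?e3; [lia | apply: val_inj].
  have /andP[_ Pj] := P j; have /andP[Pl _] := P l.
  by apply: leq_ltn_trans Pj _; apply: leq_trans (leq_mul (leqnn 2) Pl); lia.
have inj : injective (tnth (Bgen k.+2)).
  apply/tuple_uniqP; move: e0 e1 e2 e3; rewrite !(tnth_nth 0) /=.
  by move=> -> -> -> ->; rewrite /= !inE; lia.
move: (tnth _) lt2 inj {e0 e1 e2 e3} => b lt2 inj def_bi.
have c1 j : c j <= 1.
  rewrite leqNgt; apply/negP => cj; have := lt2 i j.
  rewrite def_bi ltnNge (bigD1 j) //= => /negP[].
  by apply: leq_trans (leq_addr _ _); rewrite leq_mul2r cj orbT.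
have [j cj|c0] := pickP (fun j => c j == 1); last first.
  have := lt2 i i; rewrite def_bi big1 // => j _.
  by have := c0 j; have := c1 j; case: (c j) => [|[]].
have [j' /andP[jj' cj']|c0] := pickP (fun j' => (j' != j) && (c j' == 1)).
  have [l blj] : exists l, b l <= b j /\ b l <= b j'.
    by case: (leqP (b j) (b j')) => [?|/ltnW ?]; [exists j | exists j'].
  have := lt2 i l; rewrite def_bi (bigD1 j) //= (bigD1 j') //=.
  by rewrite (eqP cj) (eqP cj') !mul1n; lia.
have eq_ij : i = j.
  apply: inj; rewrite def_bi (bigD1 j) //= (eqP cj) mul1n big1 ?addn0 //.
  move=> l lj; have := c0 l; have := c1 l; rewrite lj /=.
  by case: (c l) => [|[]].
by move: cj; rewrite -eq_ij ci.
Qed.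

End NumericalSemigroups.

Section Ideals.
Variable n : nat.
Variable K : fieldType.
Local Notation S := {mpoly K[n]}.

Definition gen_ideal (G : S -> Prop) (f : S) : Prop :=
  exists k (c g : 'I_k -> S), (forall i, G (g i)) /\ f = \sum_i c i * g i.

(* The kernel of S -> K[s], x_i |-> s^(b i), whose image is K[H] for H the     *)
(* semigroup generated by b.                                                  *)
Definition toric_ideal (b : 'I_n -> nat) (f : S) : Prop :=
  mmap (@polyC K) (fun i => 'X^(b i)) f = 0.

(* The monomial order defining mlast compares total degrees first, so mlast f *)
(* has the smallest degree in the support of f.                               *)
Definition initial_form (f : S) : S := pihomog mdeg (mdeg (mlast f)) f.

Definition tangent_cone_ideal (I : S -> Prop) : S -> Prop :=
  gen_ideal (fun g => exists f, [/\ f != 0, I f & g = initial_form f]).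

(* A minimal graded free resolution of S / I, where x_i has degree w i:       *)
(*   ... -> S^(rank 2) -> S^(rank 1) -> S^(rank 0) -> S / I -> 0.             *)
(* Elements of S^r are row vectors and maps act by right multiplication; the  *)
(* augmentation sends the j-th basis vector to the class of aug j 0. The j-th *)
(* basis vector of S^(rank i) has degree shift i j, that is,                  *)
(* S^(rank i) = \bigoplus_j S(- shift i j). Minimality says that the entries  *)
(* of all differentials lie in the ideal generated by the variables.          *)
Record minimal_graded_resolution (w : 'I_n -> nat) (I : S -> Prop) := MGR {
  rank : nat -> nat;
  aug : 'cV[S]_(rank 0);
  diff : forall i, 'M[S]_(rank i.+1, rank i);
  shift : forall i, 'I_(rank i) -> int;
  aug_surjective : exists u : 'rV_(rank 0), I ((u *m aug) 0 0 - 1);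
  aug_exact : forall u : 'rV_(rank 0),
    I ((u *m aug) 0 0) <-> exists v, u = v *m diff 0;
  diff_exact : forall i (u : 'rV_(rank i.+1)),
    u *m diff i = 0 <-> exists v, u = v *m diff i.+1;
  aug_graded : forall j m, m \in msupp (aug j 0) ->
    (\sum_l m l * w l)%N%:Z = shift j;
  diff_graded : forall i j k m, m \in msupp (diff i j k) ->
    (\sum_l m l * w l)%N%:Z + shift k = shift j;
  diff_minimal : forall i j k, (diff i j k)@_0 = 0
}.

(* The Betti sequence of S / I is s, listed up to its last nonzero entry.     *)
Definition has_betti_sequence (w : 'I_n -> nat) (I : S -> Prop) (s : seq nat) :=
  last 0%N s != 0%N /\
  exists F : minimal_graded_resolution w I, forall i, rank F i = nth 0%N s i.

End Ideals.

Arguments toric_ideal {n} K b f.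

(* Main.v *)
Require Import Defs.
From mathcomp Require Import all_boot all_order all_algebra.
From mathcomp.multinomials Require Import mpoly.
From HB Require Import structures.
From mathcomp Require Import zify ring.

(* Put k = 2h - 1, and let u = x for K[B_h], u = 0 for its tangent cone. Both
   ideals have the generators
     Q = xt - yz,
     g_i = z^i t^(k-i) - u^2 x^i y^(k-i)            (0 <= i <= k),
     f_j = y^(k+1-j) t^j - u x^(k+1-j) z^j          (0 <= j < k).
   Modulo these, every monomial becomes a standard one by rewritings
   that preserve the weight and never lower the degree; standard monomials have
   distinct weights, which gives the toric ideal for u = x and its initial forms
   for u = 0.

   The ideal (Q, g_0, ..., g_k)/(Q) is resolved by the degree k strand of the Koszul
   complex of x - yX, z - tX (with X dehomogenized), and the quotient of the whole
   ideal by (Q, g_0, ..., g_k) is the free K[x, y]-module with basis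
   1, X, ..., X^(k-1), where X^k = u^2 and z, t act as xX, yX: it is resolved by the
   Koszul complex of z - xX, t - yX over S[X]/(X^k - u^2). The mapping cone of
   these two resolutions is minimal, with ranks 1, (k+2) + k, 2k + 2k and
   (k-1) + k. *)

Set Implicit Arguments.
Unset Strict Implicit.
Unset Printing Implicit Defensive.

Import Order.TTheory GRing.Theory Num.Theory.
Local Open Scope ring_scope.

(** * The complex *)

(** The variable X shifts the index of a generator. Modulo Q it stands for x/y = z/t on the g_i, as
    x g_i - y g_(i+1) and z g_i - t g_(i+1) are multiples of Q, and for z/x = t/y on the f_j. The
    relation X^k = u^2 comes from extending f_j to j = k: then f_k - u^2 f_0 = y g_0 - u x g_k,
    whose right side, read as y - u x X^k, is the comparison term.

    The modules have finite rank, so rows are polynomials in X of bounded degree, and cofactors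
    found without a bound must be reduced afterwards.

    Quotients of S[X] by linear polynomials such as z - x X are replaced by endomorphisms of S[X]
    that eliminate variables. Their values lie in a domain and every polynomial is congruent to its
    image, so an element sent to 0 comes with explicit cofactors.

    Exactness asks of u that a few elements be nonzero and that two of the substitutions fix it;
    minimality asks that u have no constant term. Hence u = c x with c = 1 or c = 0 treats both
    algebras at once, with equal ranks. *)

Section HomogeneousEvaluation.
Variable R : comNzRingType.
Implicit Types (P : {poly R}) (p q a b : R).

(** The homogenization of P in degree n, taken at (p, q). Coefficients beyond n are dropped, which
    is why the product rules below bound the size of P. *)
Definition heval n p q P : R := \sum_(i < n.+1) P`_i * (p ^+ i * q ^+ (n - i)).

Lemma heval_linear n p q a P P' :
  heval n p q (a *: P + P') = a * heval n p q P + heval n p q P'.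
Proof.
rewrite /heval mulr_sumr -big_split /=; apply: eq_bigr => i _.
by rewrite coefD coefZ mulrDl -!mulrA.
Qed.

Lemma hevalD n p q P P' : heval n p q (P + P') = heval n p q P + heval n p q P'.
Proof. by rewrite -[P]scale1r heval_linear mul1r scale1r. Qed.

Lemma heval0 n p q : heval n p q 0 = 0.
Proof. by rewrite /heval big1 // => i _; rewrite coef0 mul0r. Qed.

Lemma hevalZ n p q a P : heval n p q (a *: P) = a * heval n p q P.
Proof. by rewrite -[a *: P]addr0 heval_linear heval0 addr0. Qed.

Lemma hevalN n p q P : heval n p q (- P) = - heval n p q P.
Proof. by rewrite -scaleN1r hevalZ mulN1r. Qed.

Lemma heval_Xn n p q i : (i <= n)%N ->
  heval n p q 'X^i = p ^+ i * q ^+ (n - i).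
Proof.
move=> le_in; rewrite /heval (bigD1 (Ordinal (le_in : (i < n.+1)%N))) //=.
rewrite coefXn eqxx mul1r big1 ?addr0 // => j; rewrite -val_eqE /= => /negPf nij.
by rewrite coefXn nij mul0r.
Qed.

Lemma heval_1 n p q : heval n p q 1 = q ^+ n.
Proof. by rewrite -(expr0 'X) heval_Xn // mul1r subn0. Qed.

Lemma hevalC n p q a : heval n p q a%:P = a * q ^+ n.
Proof. by rewrite -alg_polyC hevalZ heval_1. Qed.

Lemma hevalS n p q P : (size P <= n.+1)%N ->
  heval n.+1 p q P = q * heval n p q P.
Proof.
move=> szP; rewrite /heval big_ord_recr /= nth_default // mul0r addr0 mulr_sumr.
apply: eq_bigr => i _; rewrite subSn ?exprS; last by rewrite -ltnS.
by rewrite [RHS]mulrCA (mulrCA q).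
Qed.

Lemma heval_mul n p q P a b : (size P <= n)%N ->
  heval n p q (P * (a%:P - b *: 'X)) = (a * q - b * p) * heval n.-1 p q P.
Proof.
case: n => [|n] szP; first by rewrite (size_poly_leq0P _ szP) mul0r !heval0 mulr0.
rewrite mulrBr -scalerAr mulrC mul_polyC hevalD hevalN !hevalZ hevalS //.
rewrite mulrBl mulrA -[b * p * _]mulrA; congr (_ - b * _).
rewrite /heval big_ord_recl coefMX eqxx mul0r add0r mulr_sumr.
by apply: eq_bigr => i _; rewrite coefMX /= /bump /= add1n subSS exprS; ring.
Qed.

End HomogeneousEvaluation.

Section Complex.
Variables (R : comNzRingType) (n : nat) (x y z t u : R).
Local Notation k := n.+1.
Implicit Types (P A B C E : {poly R}) (a b : R).

Definition modulus : {poly R} := 'X^k - (u ^+ 2)%:P.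

Definition quad : R := x * t - y * z.

(** Minus the coefficient of X^k in C (z - x X) + E (t - y X) for C and E of degree at most n, hence
    the multiple of [modulus] that cancels it. *)
Definition lead2 C E : R := x * C`_n + y * E`_n.

(* [R^o] makes the types of rows modules. *)
Local Notation row1 := (R^o * {poly R} * {poly R})%type.
Local Notation row2 := (({poly R} * {poly R}) * ({poly R} * {poly R}))%type.
Local Notation row3 := ({poly R} * {poly R})%type.

(* With k = n + 1, the entries of a row (a, A, B) are the
   coefficients of the generators xt - yz, z^i t^(k-i) - u^2 x^i y^(k-i) at A_i,
   for i <= k, and y^(k+1-j) t^j - u x^(k+1-j) z^j at B_j, for j < k. *)
Definition eval1 (v : row1) : R^o :=
  v.1.1 * quad + (heval k z t v.1.2 - u ^+ 2 * heval k x y v.1.2)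
  + (y ^+ 2 * heval n t y v.2 - u * x ^+ 2 * heval n z x v.2).

(* The first two components of a row of the second module map by the Koszul
   complex of x - yX and z - tX, the other two by that of z - xX and t - yX
   modulo X^k - u^2; the remaining terms form the comparison map of the
   mapping cone. *)
Definition eval2 (v : row2) : row1 :=
  (- heval n z t v.1.1 - u ^+ 2 * heval n x y v.1.2
     + y * heval n t y v.2.1 + u * x * heval n z x v.2.2,
   v.1.1 * (x%:P - y *: 'X) + v.1.2 * (z%:P - t *: 'X)
     - lead2 v.2.1 v.2.2 *: (y%:P - (u * x) *: 'X^k),
   v.2.1 * (z%:P - x *: 'X) + v.2.2 * (t%:P - y *: 'X)
     + lead2 v.2.1 v.2.2 *: modulus).

Definition eval3 (v : row3) : row2 :=
  ((v.1 * (z%:P - t *: 'X) + v.2`_n *: ((y * t)%:P - (u * x * z) *: 'X^n),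
    - (v.1 * (x%:P - y *: 'X) + v.2`_n *: ((y ^+ 2)%:P - (u * x ^+ 2) *: 'X^n))),
   (v.2 * (t%:P - y *: 'X) + (y * v.2`_n) *: modulus,
    - (v.2 * (z%:P - x *: 'X) + (x * v.2`_n) *: modulus))).

Lemma eval1_linear : linear eval1.
Proof.
move=> a v w; rewrite /eval1 /= !heval_linear.
rewrite -[a *: v.1.1]/(a * v.1.1) -[RHS]/(a * _ + _); ring.
Qed.

Lemma eval2_linear : linear eval2.
Proof.
move=> a [[C' E'] [C E]] [[F' G'] [F G]]; rewrite /eval2 /lead2 /=.
congr (_, _, _) => /=.
- by rewrite !heval_linear -[RHS]/(a * _ + _); ring.
- by rewrite !coefD !coefZ -!mul_polyC; ring.
- by rewrite !coefD !coefZ -!mul_polyC; ring.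
Qed.

Lemma eval3_linear : linear eval3.
Proof.
move=> a [D' D] [F' F]; rewrite /eval3 /=.
by congr (_, _, (_, _)) => /=; rewrite !coefD !coefZ -!mul_polyC; ring.
Qed.

Lemma size_mul_lin P a b m : (size P <= m)%N ->
  (size (P * (a%:P - b *: 'X))%R <= m.+1)%N.
Proof.
move=> szP; apply/leq_sizeP => j lt_mj.
rewrite mulrBr mulrC -scalerAr coefB coefCM coefZ coefMX.
by rewrite !nth_default ?mulr0 ?if_same ?mulr0 ?subrr //; apply: leq_trans szP _; lia.
Qed.

(* The top coefficient of P * (a - b X) is cancelled by that of b P_n M. *)
Lemma size_reduce P a b : (size P <= k)%N ->
  (size (P * (a%:P - b *: 'X) + (b * P`_n) *: modulus)%R <= k)%N.
Proof.
move=> szP; apply/leq_sizeP => j; rewrite leq_eqVlt => /orP[/eqP<-|lt_kj].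
  rewrite coefD coefZ mulrBr mulrC -scalerAr coefB coefCM coefZ coefMX /=.
  by rewrite nth_default // coefB coefXn eqxx coefC /= subr0; ring.
rewrite nth_default //; apply: leq_trans lt_kj.
rewrite (leq_trans (size_polyD _ _)) // geq_max size_mul_lin //=.
apply: (leq_trans (size_scale_leq _ _)).
rewrite (leq_trans (size_polyD _ _)) // geq_max size_polyXn leqnn.
by rewrite size_polyN (leq_trans (size_polyC_leq1 _)).
Qed.

Lemma eval12 (v : row2) :
  (size v.1.1 <= k)%N -> (size v.1.2 <= k)%N ->
  (size v.2.1 <= k)%N -> (size v.2.2 <= k)%N ->
  eval1 (eval2 v) = 0.
Proof.
move: v => [[C' E'] [C E]] /= sC' sE' sC sE; rewrite /eval1 /eval2 /=.
set L := lead2 C E; set B := (X in y ^+ 2 * heval n t y X).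
(* As [B] has no term in X^k, its evaluations can be raised from degree n to degree k, where linear
   factors split off by [heval_mul]. *)
have sB : (size B <= k)%N.
  rewrite (_ : B = (C * (z%:P - x *: 'X) + (x * C`_n) *: modulus)
    + (E * (t%:P - y *: 'X) + (y * E`_n) *: modulus)); last first.
    by rewrite /B /L /lead2 scalerDl; ring.
  by rewrite (leq_trans (size_polyD _ _)) // geq_max !size_reduce.
have -> : y ^+ 2 * heval n t y B - u * x ^+ 2 * heval n z x B
  = y * heval k t y B - u * x * heval k z x B by rewrite !hevalS //; ring.
rewrite /B /modulus !(hevalD, hevalN, hevalZ, hevalC) !heval_mul // !heval_Xn //.
by rewrite !subnn /quad; ring.
Qed.

Lemma eval23 (v : row3) : (size v.1 <= n)%N -> (size v.2 <= k)%N -> eval2 (eval3 v) = 0.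
Proof.
move: v => [D' D] /= sD' sD; rewrite /eval2 /eval3 /=.
set l := D`_n; set C := _ + (y * l) *: _; set E := _ + (x * l) *: _.
have sC : (size C <= k)%N by rewrite size_reduce.
have sE : (size E <= k)%N by rewrite size_reduce.
have L : lead2 C (- E) = l * quad.
  rewrite /lead2 coefN /C /E !(coefD, coefZ) !mulrBr !coefB.
  rewrite ![D * _%:P]mulrC -!scalerAr !coefCM !coefZ -/l /quad; ring.
rewrite L; congr (_, _, _).
- set P := _ + l *: _; set P' := _ + l *: _.
  apply: (@etrans R _ (- heval n z t P + u ^+ 2 * heval n x y P'
    + (heval k t y C - u * heval k z x E)) 0).
    by rewrite !hevalS // !hevalN; ring.
  rewrite /P /P' /C /E /modulus !(hevalD, hevalN, hevalZ, hevalC) !heval_mul //.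
  by rewrite !heval_Xn // !subnn !exprS; ring.
- rewrite -[RHS]/(0 : {poly R}) -!mul_polyC /quad !(rmorphM, rmorphB, rmorphXn) /=.
  by rewrite exprS; ring.
- rewrite -[RHS]/(0 : {poly R}) /C /E -!mul_polyC /quad.
  by rewrite !(rmorphM, rmorphB, rmorphXn) /=; ring.
Qed.
End Complex.

Lemma mul_rV_linear (R : comNzRingType) m p (f : 'rV[R]_m -> 'rV[R]_p) :
  linear f -> forall v, v *m lin1_mx f = f v.
Proof.
move=> lin_f v.
pose F : {linear 'rV[R]_m -> 'rV[R]_p} :=
  HB.pack f (GRing.isLinear.Build _ _ _ _ f lin_f).
exact: (mul_rV_lin1 F).
Qed.

Section Rows.
Variables (R : comNzRingType) (n : nat) (x y z t u : R).
Local Notation k := n.+1.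
Local Notation row1 := (R^o * {poly R} * {poly R})%type.
Local Notation row2 := (({poly R} * {poly R}) * ({poly R} * {poly R}))%type.
Local Notation row3 := ({poly R} * {poly R})%type.

Definition short1 (w : row1) :=
  (size w.1.2 <= k.+1)%N && (size w.2 <= k)%N.
Definition short2 (w : row2) :=
  [&& size w.1.1 <= k, size w.1.2 <= k, size w.2.1 <= k & size w.2.2 <= k]%N.
Definition short3 (w : row3) := (size w.1 <= n)%N && (size w.2 <= k)%N.

Definition pack1 (w : row1) : 'rV[R]_(1 + k.+1 + k) :=
  row_mx (row_mx (w.1.1 : R)%:M (poly_rV w.1.2)) (poly_rV w.2).
Definition pack2 (w : row2) : 'rV[R]_(k + k + (k + k)) :=
  row_mx (row_mx (poly_rV w.1.1) (poly_rV w.1.2))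
         (row_mx (poly_rV w.2.1) (poly_rV w.2.2)).

Definition unpack1 (v : 'rV[R]_(1 + k.+1 + k)) : row1 :=
  (lsubmx (lsubmx v) 0 0, rVpoly (rsubmx (lsubmx v)), rVpoly (rsubmx v)).
Definition unpack2 (v : 'rV[R]_(k + k + (k + k))) : row2 :=
  ((rVpoly (lsubmx (lsubmx v)), rVpoly (rsubmx (lsubmx v))),
   (rVpoly (lsubmx (rsubmx v)), rVpoly (rsubmx (rsubmx v)))).
Definition unpack3 (v : 'rV[R]_(n + k)) : row3 :=
  (rVpoly (lsubmx v), rVpoly (rsubmx v)).
Definition pack3 (w : row3) : 'rV[R]_(n + k) :=
  row_mx (poly_rV w.1) (poly_rV w.2).

Lemma unpack1K : cancel unpack1 pack1.
Proof.
by move=> v; rewrite /pack1 !rVpolyK -mx11_scalar !hsubmxK.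
Qed.
Lemma unpack2K : cancel unpack2 pack2.
Proof. by move=> v; rewrite /pack2 !rVpolyK !hsubmxK. Qed.
Lemma unpack3K : cancel unpack3 pack3.
Proof. by move=> v; rewrite /pack3 !rVpolyK !hsubmxK. Qed.

Lemma pack1K w : short1 w -> unpack1 (pack1 w) = w.
Proof.
case: w => [[a A] B] /andP[sA sB]; rewrite /unpack1 /pack1 !(row_mxKl, row_mxKr) /=.
by rewrite !poly_rV_K // mxE.
Qed.
Lemma pack2K w : short2 w -> unpack2 (pack2 w) = w.
Proof.
case: w => [[A B] [C E]] /and4P[sA sB sC sE].
by rewrite /unpack2 /pack2 !(row_mxKl, row_mxKr) !poly_rV_K.
Qed.
Lemma pack3K w : short3 w -> unpack3 (pack3 w) = w.
Proof.
case: w => [A B] /andP[sA sB].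
by rewrite /unpack3 /pack3 !(row_mxKl, row_mxKr) !poly_rV_K.
Qed.

Lemma short_unpack1 v : short1 (unpack1 v).
Proof. by rewrite /short1 !size_poly. Qed.
Lemma short_unpack2 v : short2 (unpack2 v).
Proof. by rewrite /short2 !size_poly. Qed.
Lemma short_unpack3 v : short3 (unpack3 v).
Proof. by rewrite /short3 !size_poly. Qed.

Lemma short_eval2 w : short2 w -> short1 (eval2 n x y z t u w).
Proof.
case: w => [[A B] [C E]] /and4P[sA sB sC sE]; apply/andP; split => /=.
  rewrite (leq_trans (size_polyD _ _)) // geq_max size_polyN.
  rewrite (leq_trans (size_polyD _ _)) /=; last first.
    by rewrite geq_max !size_mul_lin.
  apply: leq_trans (size_scale_leq _ _) _.
  rewrite (leq_trans (size_polyD _ _)) // geq_max size_polyN.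
  rewrite (leq_trans (size_polyC_leq1 _)) //=.
  by rewrite (leq_trans (size_scale_leq _ _)) // size_polyXn.
rewrite (_ : _ + _ = (C * (z%:P - x *: 'X) + (x * C`_n) *: modulus n u)
    + (E * (t%:P - y *: 'X) + (y * E`_n) *: modulus n u)); last first.
  by rewrite /lead2 scalerDl; ring.
by rewrite (leq_trans (size_polyD _ _)) // geq_max !size_reduce.
Qed.

Lemma short_eval3 w : short3 w -> short2 (eval3 n x y z t u w).
Proof.
case: w => [A B] /andP[sA sB]; rewrite /short2 /= !size_polyN !size_reduce //=.
have sz c a b : (size (A * (a%:P - b *: 'X) +
    B`_n *: (c.1%:P - c.2 *: 'X^n))%R <= k)%N.
  rewrite (leq_trans (size_polyD _ _)) // geq_max size_mul_lin //=.
  apply: leq_trans (size_scale_leq _ _) _.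
  rewrite (leq_trans (size_polyD _ _)) // geq_max size_polyN.
  rewrite (leq_trans (size_polyC_leq1 _)) //=.
  by rewrite (leq_trans (size_scale_leq _ _)) // size_polyXn.
by rewrite (sz (_, _)) (sz (_, _)).
Qed.

Definition diff1 (v : 'rV[R]_(1 + k.+1 + k)) : 'rV[R]_1 :=
  (eval1 n x y z t u (unpack1 v) : R)%:M.
Definition diff2 v := pack1 (eval2 n x y z t u (unpack2 v)).
Definition diff3 v := pack2 (eval3 n x y z t u (unpack3 v)).

Definition diff1_mx : 'M[R]_(1 + k.+1 + k, 1) := lin1_mx diff1.
Definition diff2_mx : 'M[R]_(k + k + (k + k), 1 + k.+1 + k) := lin1_mx diff2.
Definition diff3_mx : 'M[R]_(n + k, k + k + (k + k)) := lin1_mx diff3.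

Lemma mul_diff_mx1 v : v *m diff1_mx = diff1 v.
Proof.
apply: mul_rV_linear => a v1 v2; rewrite /diff1.
have -> : unpack1 (a *: v1 + v2) = a *: unpack1 v1 + unpack1 v2.
  by rewrite /unpack1 !linearP /= !mxE.
by rewrite eval1_linear raddfD /= -scale_scalar_mx.
Qed.

Lemma mul_diff_mx2 v : v *m diff2_mx = diff2 v.
Proof.
apply: mul_rV_linear => a v1 v2; rewrite /diff2.
have -> : unpack2 (a *: v1 + v2) = a *: unpack2 v1 + unpack2 v2.
  by rewrite /unpack2 !linearP.
rewrite eval2_linear; set w := eval2 _ _ _ _ _ _ _; set w' := eval2 _ _ _ _ _ _ _.
rewrite /pack1 /= !linearP /= !scale_row_mx !add_row_mx; congr (row_mx (row_mx _ _) _).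
by rewrite raddfD /= -scale_scalar_mx.
Qed.

Lemma mul_diff_mx3 v : v *m diff3_mx = diff3 v.
Proof.
apply: mul_rV_linear => a v1 v2; rewrite /diff3.
have -> : unpack3 (a *: v1 + v2) = a *: unpack3 v1 + unpack3 v2.
  by rewrite /unpack3 !linearP.
by rewrite eval3_linear /pack2 /= !linearP /= !scale_row_mx !add_row_mx.
Qed.

End Rows.

(** * Exactness *)

Section Koszul.
Variable T : idomainType.

(** The pair p, q is a regular sequence: modulo p, which generates the kernel of [phi], q becomes a
    nonzero element of a domain. *)
Lemma koszul_pair (phi : {rmorphism T -> T}) (p q a b : T) :
    (forall f, phi f = 0 -> exists g, f = g * p) ->
    p != 0 -> phi p = 0 -> phi q != 0 -> a * p + b * q = 0 ->
  exists s, a = s * q /\ b = - (s * p).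
Proof.
move=> kerphi p0 phip phiq abpq.
have /kerphi[s Db] : phi b = 0.
  move/(congr1 phi): abpq; rewrite rmorph0 rmorphD !rmorphM phip mulr0 add0r.
  by move/eqP; rewrite mulf_eq0 (negPf phiq) orbF => /eqP.
exists (- s); split; last by rewrite Db; ring.
apply: (mulIf p0); apply/eqP; rewrite -subr_eq0; apply/eqP; rewrite -abpq Db.
by ring.
Qed.

(* Cofactors of too large degree have top coefficients [r t], [- r y], and are
   lowered by subtracting a multiple of the Koszul relation. *)
Lemma koszul_short (x y z t : T) n (C E : {poly T}) :
    (forall a b, a * y + b * t = 0 -> exists s, a = s * t /\ b = - (s * y)) ->
    (size (C * (x%:P - y *: 'X) + E * (z%:P - t *: 'X))%R <= n.+2)%N ->
  exists C' E' : {poly T}, [/\ (size C' <= n.+1)%N, (size E' <= n.+1)%N &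
    C * (x%:P - y *: 'X) + E * (z%:P - t *: 'X)
      = C' * (x%:P - y *: 'X) + E' * (z%:P - t *: 'X)].
Proof.
move=> koszul; move: {2}(maxn (size C) (size E)) (leqnn (maxn (size C) (size E))).
move=> N; elim: N C E => [|N IHN] C E.
  rewrite geq_max => /andP[sC sE] _; exists C, E; split=> //.
    exact: leq_trans sC _.
  exact: leq_trans sE _.
rewrite geq_max => /andP[sC sE] sCE.
have [leNn|ltnN] := leqP N n.
  by exists C, E; split=> //; [apply: leq_trans sC _ | apply: leq_trans sE _].
case: N ltnN IHN sC sE => // N leNn IHN sC sE.
have [r [DC DE]] : exists r, C`_N.+1 = r * t /\ E`_N.+1 = - (r * y).
  apply: koszul; move/leq_sizeP/(_ N.+2 leNn): sCE.
  rewrite coefD !mulrBr !coefB ![_ * _%:P]mulrC -!scalerAr !coefCM !coefZ !coefMX /=.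
  rewrite (nth_default _ sC) (nth_default _ sE) => /eqP.
  rewrite !mulr0 !sub0r -opprD oppr_eq0 => /eqP yCtE.
  by rewrite [_ * y]mulrC [_ * t]mulrC.
have size_lower (P : {poly T}) a b s : (size P <= N.+2)%N -> P`_N.+1 = s * b ->
    (size (P + s *: 'X^N * (a%:P - b *: 'X))%R <= N.+1)%N.
  move=> sP DP; apply/leq_sizeP => j; rewrite leq_eqVlt.
  rewrite coefD -scalerAl mulrBr ['X^N * _]mulrC -scalerAr -exprSr.
  rewrite coefZ coefB coefCM coefZ !coefXn => /orP[/eqP<-|lt_Nj].
    by rewrite DP eqxx (gtn_eqF (ltnSn N)) mulr0 mulr1 sub0r mulrN subrr.
  rewrite nth_default ?(leq_trans sP) // !gtn_eqF ?(ltnW lt_Nj) //.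
  by rewrite !mulr0 subrr mulr0 addr0.
pose C1 := C + r *: 'X^N * (z%:P - t *: 'X).
pose E1 := E + (- r) *: 'X^N * (x%:P - y *: 'X).
have DCE : C * (x%:P - y *: 'X) + E * (z%:P - t *: 'X)
         = C1 * (x%:P - y *: 'X) + E1 * (z%:P - t *: 'X).
  by rewrite /C1 /E1 -!mul_polyC rmorphN /=; ring.
rewrite DCE; apply: IHN; last by rewrite -DCE.
by rewrite geq_max !size_lower // DE mulNr.
Qed.

End Koszul.

(** * Regular elements modulo X^k - u^2 *)

Section MonicModulus.
Variables (R : idomainType) (n : nat) (u : R).
Local Notation k := n.+1.
Local Notation M := (modulus n u).

Lemma size_modulus : size M = k.+1.
Proof.
by rewrite size_polyDl ?size_polyXn // size_polyN (leq_ltn_trans (size_polyC_leq1 _)).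
Qed.

Lemma monic_modulus : M \is monic.
Proof.
rewrite monicE lead_coefDl ?lead_coefXn // size_polyXn size_polyN.
by rewrite (leq_ltn_trans (size_polyC_leq1 _)).
Qed.

Lemma modulus_div (P : {poly R}) : exists Q r, P = Q * M + r /\ (size r <= k)%N.
Proof.
exists (Pdiv.Ring.rdivp P M), (Pdiv.Ring.rmodp P M); split.
  exact: Pdiv.RingMonic.rdivp_eq monic_modulus P.
by rewrite -ltnS -size_modulus Pdiv.Ring.ltn_rmodp monic_neq0 ?monic_modulus.
Qed.

Lemma modulus_short (Q r : {poly R}) : (size r <= k)%N -> Q * M = r -> Q = 0.
Proof.
move=> sr Dr; apply/eqP; apply: contraLR sr => Q0; rewrite -Dr -ltnNge.
rewrite size_Mmonic ?monic_modulus // size_modulus addnS /= -[X in (X < _)%N]add0n.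
by rewrite ltn_add2r size_poly_gt0.
Qed.

(** Polynomials modulo the monic [M] form a free module over the domain R, with the remainders of
    size at most k as representatives. *)
Lemma modulus_reg (c : R) (P Q : {poly R}) : c != 0 -> c *: P = Q * M ->
  exists Q', P = Q' * M.
Proof.
move=> c0; have [Q' [r [-> sr]]] := modulus_div P => DQ.
exists Q'; suff -> : r = 0 by rewrite addr0.
have Dr : (Q - c *: Q') * M = c *: r by rewrite mulrBl -DQ scalerDr -scalerAl; ring.
have := modulus_short _ Dr; rewrite (leq_trans (size_scale_leq _ _)) // => /(_ isT) Q0.
by move: Dr; rewrite Q0 mul0r => /esym/eqP; rewrite scale_poly_eq0 (negPf c0) => /eqP.
Qed.

(** The element a^k - b^k u^2 is the norm of a - b X modulo X^k - u^2. The geometric sum [W] is the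
    cofactor: (a - b X) W = a^k - b^k X^k, so a nonzero norm reduces the claim to a scalar. *)
Lemma modulus_lin_reg (a b : R) (P Q : {poly R}) :
    a ^+ k - b ^+ k * u ^+ 2 != 0 -> P * (a%:P - b *: 'X) = Q * M ->
  exists Q', P = Q' * M.
Proof.
move=> ab0 DQ.
pose W := \sum_(i < k) a%:P ^+ (k.-1 - i) * (b *: 'X) ^+ i : {poly R}.
apply: (modulus_reg (Q := Q * W + b ^+ k *: P) ab0).
rewrite mulrDl mulrAC -DQ -mulrA -subrXX /modulus.
rewrite exprZn -!mul_polyC !(rmorphB, rmorphM, rmorphXn) /=; ring.
Qed.

End MonicModulus.

Local Notation ix := (@Ordinal 4 0 isT).
Local Notation iy := (@Ordinal 4 1 isT).
Local Notation iz := (@Ordinal 4 2 isT).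
Local Notation it := (@Ordinal 4 3 isT).

Lemma forall_ord4 (P : 'I_4 -> Prop) : P ix -> P iy -> P iz -> P it -> forall i, P i.
Proof.
move=> Px Py Pz Pt [[|[|[|[|//]]]] lt_i].
- by rewrite (_ : Ordinal _ = ix) //; apply: val_inj.
- by rewrite (_ : Ordinal _ = iy) //; apply: val_inj.
- by rewrite (_ : Ordinal _ = iz) //; apply: val_inj.
- by rewrite (_ : Ordinal _ = it) //; apply: val_inj.
Qed.

(** * Substitutions that eliminate variables *)

Section Congruence.
Variables (A : comNzRingType) (phi : {rmorphism A -> A}) (I : A -> Prop).
Hypotheses (ID : forall f g, I f -> I g -> I (f + g)).
Hypotheses (IM : forall f g, I g -> I (f * g)).

Lemma congr_morphD f g :
  I (f - phi f) -> I (g - phi g) -> I (f + g - phi (f + g)).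
Proof. by move=> If Ig; rewrite rmorphD opprD addrACA; apply: ID. Qed.

Lemma congr_morphM f g :
  I (f - phi f) -> I (g - phi g) -> I (f * g - phi (f * g)).
Proof.
move=> If Ig; rewrite rmorphM /=.
rewrite (_ : _ - _ = phi g * (f - phi f) + f * (g - phi g)); last by ring.
by apply: ID; apply: IM.
Qed.

End Congruence.

Section Substitution.
Variables (K : fieldType) (m : nat).
Local Notation S := {mpoly K[m]}.
Local Notation T := {poly S}.
Variable h : 'I_m -> T.

(** Mapping the coefficients into S[X] gives a polynomial over S[X]; evaluating its outer variable
    at X returns to S[X] and keeps X fixed. *)
Definition subst : T -> T :=
  horner_eval 'X \o map_poly (mmap (polyC \o mpolyC m (R := K)) h).

HB.instance Definition _ := GRing.RMorphism.on subst.

Lemma substX : subst 'X = 'X.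
Proof. by rewrite /subst /= map_polyX /horner_eval hornerX. Qed.

Lemma subst_mmap c : subst c%:P = mmap (polyC \o mpolyC m (R := K)) h c.
Proof. by rewrite /subst /= map_polyC /horner_eval hornerC. Qed.

Lemma subst_var i : subst ('X_i)%:P = h i.
Proof. by rewrite subst_mmap mmapX mmap1U. Qed.

Lemma subst_const c : subst (c%:MP)%:P = (c%:MP)%:P.
Proof. by rewrite subst_mmap mmapC. Qed.

Lemma substM f g : subst (f * g) = subst f * subst g.
Proof. exact: (rmorphM subst). Qed.

(** The elements congruent to their image are closed under sums and products, so constants, X and
    the variables suffice. *)
Lemma subst_congr (I : T -> Prop) :
    I 0 -> (forall f g, I f -> I g -> I (f + g)) ->
    (forall f g, I g -> I (f * g)) -> (forall i, I (('X_i)%:P - h i)) ->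
  forall f, I (f - subst f).
Proof.
move=> I0 ID IM Ih.
have JD f g : I (f - subst f) -> I (g - subst g) -> I (f + g - subst (f + g)).
  exact: (@congr_morphD T subst I ID).
have JM f g : I (f - subst f) -> I (g - subst g) -> I (f * g - subst (f * g)).
  exact: (@congr_morphM T subst I ID IM).
have J1 : I (1 - subst 1) by rewrite (rmorph1 subst) subrr.
have JE i e : I (('X_i ^+ e)%:P - subst ('X_i ^+ e)%:P).
  elim: e => [|e IHe]; first by rewrite expr0.
  by rewrite exprS polyCM; apply: (JM) IHe; rewrite subst_var; apply: Ih.
have JC c : I (c%:P - subst c%:P).
  elim/mpolyind: c => [|c m' p _ _ Ip].
    by rewrite polyC0 (rmorph0 subst) subrr.
  rewrite polyCD; apply: (JD); last exact: Ip.
  rewrite -mul_mpolyC polyCM; apply: (JM).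
    by rewrite subst_const subrr.
  rewrite mpolyXE_id rmorph_prod.
  apply: (big_ind (fun f => I (f - subst f)) J1 JM) => i _; exact: JE.
elim/poly_ind => [|p c Ip]; first by rewrite (rmorph0 subst) subrr.
by apply: (JD) (JC c); apply: (JM) Ip _; rewrite substX subrr.
Qed.

Lemma subst_congr1 p : (forall i, exists g, ('X_i)%:P - h i = g * p) ->
  forall f, exists g, f - subst f = g * p.
Proof.
move=> Ih; apply: (@subst_congr (fun f => exists g, f = g * p) _ _ _ Ih)
  => [|f g [a ->] [b ->]|f g [a ->]].
- by exists 0; rewrite mul0r.
- by exists (a + b); rewrite mulrDl.
- by exists (f * a); rewrite mulrA.
Qed.

Lemma subst_congr2 p q : (forall i, exists a b, ('X_i)%:P - h i = a * p + b * q) ->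
  forall f, exists a b, f - subst f = a * p + b * q.
Proof.
move=> Ih; apply: (@subst_congr (fun f => exists a b, f = a * p + b * q) _ _ _ Ih)
  => [|f g [a [b ->]] [c [d ->]]|f g [a [b ->]]].
- by exists 0, 0; rewrite !mul0r addr0.
- by exists (a + c), (b + d); ring.
- by exists (f * a), (f * b); ring.
Qed.

End Substitution.

Section PolyMorphism.
Variables (R : comNzRingType) (phi : {rmorphism {poly R} -> {poly R}}).

Lemma morph_heval n (p q : R) (P : {poly R}) :
  phi (heval n p q P)%:P
  = \sum_(i < n.+1) phi (P`_i)%:P * (phi p%:P ^+ i * phi q%:P ^+ (n - i)).
Proof.
rewrite /heval !rmorph_sum /=; apply: eq_bigr => i _.
by rewrite !polyCM !polyC_exp !(rmorphM, rmorphXn).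
Qed.

Lemma morph_poly n (P : {poly R}) : phi 'X = 'X -> (size P <= n.+1)%N ->
  phi P = \sum_(i < n.+1) phi (P`_i)%:P * 'X ^+ i.
Proof.
move=> phiX sP; rewrite -[P in LHS](poly_rV_K sP) /rVpoly poly_def rmorph_sum.
apply: eq_bigr => i _; rewrite valK mxE -mul_polyC rmorphM /=.
by rewrite [X in _ * X]rmorphXn /= phiX.
Qed.

(* If p and q are sent to c X and c, homogeneous evaluation at (p, q) becomes
   evaluation at X, up to a power of c. *)
Lemma morph_heval_X n (p q : R) (c P : {poly R}) :
  phi 'X = 'X -> phi p%:P = c * 'X -> phi q%:P = c -> (size P <= n.+1)%N ->
  phi (heval n p q P)%:P = c ^+ n * phi P.
Proof.
move=> phiX phip phiq sP; rewrite morph_heval (morph_poly phiX sP) mulr_sumr.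
apply: eq_bigr => i _; rewrite phip phiq exprMn.
have <- : c ^+ i * c ^+ (n - i) = c ^+ n by rewrite -exprD subnKC // -ltnS.
by ring.
Qed.

End PolyMorphism.

(** * Exactness over a domain *)

Section Exactness.
Variables (R : idomainType) (n : nat) (x y z t u : R).
Local Notation k := n.+1.
Local Notation T := {poly R}.
Local Notation row1 := (R^o * {poly R} * {poly R})%type.
Local Notation row2 := (({poly R} * {poly R}) * ({poly R} * {poly R}))%type.
Local Notation row3 := ({poly R} * {poly R})%type.
Local Notation M := (modulus n u).
Local Notation eval1 := (eval1 n x y z t u).
Local Notation eval2 := (eval2 n x y z t u).
Local Notation eval3 := (eval3 n x y z t u).

Variables sigma eta theta pi upsilon : {rmorphism T -> T}.

Hypothesis sigma_val : [/\ sigma 'X = 'X, sigma x%:P = x%:P, sigma y%:P = y%:P,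
  sigma z%:P = x%:P * 'X & sigma t%:P = y%:P * 'X].
Hypothesis sigma_u : sigma u%:P = u%:P.
Hypothesis sigma_congr : forall P : T, exists C E,
  P - sigma P = C * (z%:P - x *: 'X) + E * (t%:P - y *: 'X).

Hypothesis eta_val : [/\ eta 'X = 'X, eta x%:P = y%:P * 'X, eta y%:P = y%:P,
  eta z%:P = t%:P * 'X & eta t%:P = t%:P].
Hypothesis eta_u : t%:P ^+ k - eta u%:P ^+ 2 * y%:P ^+ k != 0.
Hypothesis eta_congr : forall P : T, exists C E,
  P - eta P = C * (x%:P - y *: 'X) + E * (z%:P - t *: 'X).

Hypothesis theta_val : [/\ theta 'X = 'X, theta x%:P = y%:P * 'X,
  theta y%:P = y%:P, theta z%:P = z%:P & theta t%:P = t%:P].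
Hypothesis theta_congr : forall P : T, exists C, P - theta P = C * (x%:P - y *: 'X).

Hypothesis pi_val : [/\ pi 'X = 'X, pi x%:P = x%:P,
  pi y%:P = y%:P, pi z%:P = x%:P * 'X & pi t%:P = t%:P].
Hypothesis pi_u : pi u%:P = u%:P.
Hypothesis pi_congr : forall P : T, exists C, P - pi P = C * (z%:P - x *: 'X).

Hypothesis upsilon_y : upsilon y%:P = 0.
Hypothesis upsilon_t : upsilon t%:P = t%:P.
Hypothesis upsilon_congr : forall P : T, exists C, P - upsilon P = C * y%:P.

Hypotheses (y0 : y != 0) (t0 : t != 0) (quad0 : quad x y z t != 0).
Hypothesis regF : y ^+ n.+2 - u * x ^+ n.+2 != 0.
Hypothesis regt : t ^+ k - y ^+ k * u ^+ 2 != 0.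
Hypothesis regz : z ^+ k - x ^+ k * u ^+ 2 != 0.

Lemma koszul_yt (a b : R) : a * y + b * t = 0 ->
  exists s, a = s * t /\ b = - (s * y).
Proof.
move=> abyt; have [|||||s [Da Db]] := @koszul_pair _ upsilon y%:P t%:P a%:P b%:P.
- by move=> f f0; have [C] := upsilon_congr f; rewrite f0 subr0; exists C.
- by rewrite polyC_eq0.
- by [].
- by rewrite upsilon_t polyC_eq0.
- by rewrite -!polyCM -polyCD abyt.
exists s`_0; split.
  by move/(congr1 (coefp 0)): Da; rewrite /= coefC coefMC.
by move/(congr1 (coefp 0)): Db; rewrite /= coefC coefN coefMC.
Qed.

Lemma lin_neq0 (a b : R) : b != 0 -> (a%:P - b *: 'X : T) != 0.
Proof.
apply: contra_neq => /(congr1 (coefp 1)) /=.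
by rewrite coefB coefC coefZ coefX coef0 mulr1 sub0r => /eqP; rewrite oppr_eq0 => /eqP.
Qed.

Lemma koszul_G (C E : T) :
  C * (x%:P - y *: 'X) + E * (z%:P - t *: 'X) = 0 ->
  exists s, C = s * (z%:P - t *: 'X) /\ E = - (s * (x%:P - y *: 'X)).
Proof.
have [tX tx ty tz tt] := theta_val; apply: (@koszul_pair _ theta).
- by move=> f f0; have [D] := theta_congr f; rewrite f0 subr0; exists D.
- exact: lin_neq0.
- by rewrite -mul_polyC rmorphB rmorphM /= tx ty tX subrr.
- by rewrite -mul_polyC rmorphB rmorphM /= tz tt tX mul_polyC lin_neq0.
Qed.

(** Under [eta] the quadric vanishes and the rest becomes (t^k - eta(u)^2 y^k) eta(A). So eta(A) =
    0, and A has cofactors at x - y X and z - t X, which [koszul_short] makes short. The entry a is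
    then forced because [quad] is nonzero. *)
Lemma exact1_reduced w : short1 n w -> w.2 = 0 -> eval1 w = 0 ->
  exists v, short2 n v /\ w = eval2 v.
Proof.
case: w => [[a A] B] /andP[/= sA _] -> {B}.
rewrite /eval1 /= !heval0 !mulr0 subrr addr0 => w0.
have [eX ex ey ez et] := eta_val.
have etaA : eta A = 0.
  move: w0 => /(congr1 (fun c => eta c%:P)); rewrite /quad polyC0 rmorph0.
  rewrite polyCD polyCM !polyCB !polyCM !(rmorphD, rmorphN, rmorphM) /=.
  rewrite (morph_heval_X eX ez et sA) (morph_heval_X eX ex ey sA) ex ey ez et.
  rewrite (_ : _ + _ = (t%:P ^+ k - eta u%:P ^+ 2 * y%:P ^+ k) * eta A).
    by move/eqP; rewrite mulf_eq0 (negPf eta_u) => /eqP.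
  by ring.
have [C [E]] := eta_congr A; rewrite etaA subr0 => DA.
have [|C' [E' [sC' sE' DA']]] := @koszul_short _ x y z t n C E koszul_yt.
  by rewrite -DA.
exists ((C', E'), (0, 0)); split; first by rewrite /short2 /= sC' sE' size_poly0.
have := @eval12 _ n x y z t u ((C', E'), (0, 0)).
rewrite /= sC' sE' size_poly0 => /(_ isT isT isT isT).
rewrite /eval1 /eval2 /= /lead2 !coef0 !heval0 !mulr0 !mul0r !addr0 !scale0r subr0 addr0.
rewrite -DA' -DA !heval0 !mulr0 subrr addr0 => w1.
congr (_, _, _).
apply: (mulIf quad0).
by apply: (addIr (heval k z t A - u ^+ 2 * heval k x y A)); rewrite w0 w1.
Qed.

(** Applying [sigma] leaves (X^k - u^2) H + (y^(k+1) - u x^(k+1)) sigma(B) = 0, where H is the image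
    of the evaluation of A at (x, y). By [regF], M divides sigma(B), so B lies in the ideal of M, z
    - x X and t - y X; subtracting a row of the image of [eval2] removes it. *)
Lemma exact1 w : short1 n w -> eval1 w = 0 -> exists v, short2 n v /\ w = eval2 v.
Proof.
move=> sw w0; have /andP[sA sB] := sw.
have [sX sx sy sz st] := sigma_val.
have [Q DB] : exists Q, sigma w.2 = Q * M.
  pose H := \sum_(i < k.+1) sigma (w.1.2`_i)%:P * (x%:P ^+ i * y%:P ^+ (k - i)).
  have HA : sigma (heval k z t w.1.2)%:P = 'X^k * H.
    rewrite morph_heval sz st mulr_sumr; apply: eq_bigr => i _.
    rewrite !exprMn -[in 'X^k](subnKC (ltnSE (ltn_ord i))) exprD; ring.
  have HA' : sigma (heval k x y w.1.2)%:P = H by rewrite morph_heval sx sy.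
  apply: (@modulus_reg _ n u _ _ (- H)) regF _.
  move: w0 => /(congr1 (fun c => sigma c%:P)); rewrite /eval1 /quad polyC0 rmorph0.
  rewrite !polyCD !polyCM !polyCB !polyCM !(rmorphD, rmorphN, rmorphM) /=.
  rewrite HA HA' (morph_heval_X sX st sy sB) (morph_heval_X sX sz sx sB).
  rewrite sx sy sz st sigma_u => w0.
  rewrite -mul_polyC polyCB polyC_exp (polyCM u) !polyC_exp !exprS /modulus polyC_exp.
  apply/eqP; rewrite -subr_eq0 -w0; apply/eqP; ring.
have [C [E]] := sigma_congr w.2; rewrite DB => {}DB.
have [C0 [C1 [DC sC1]]] := modulus_div n u C.
have [E0 [E1 [DE sE1]]] := modulus_div n u E.
pose v1 : row2 := ((0, 0), (C1, E1)).
have sv1 : short2 n v1 by rewrite /short2 /= size_poly0 sC1 sE1.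
have [v2 [sv2 Dv2]] : exists v2, short2 n v2 /\ w - eval2 v1 = eval2 v2.
  have sw1 : short1 n (w - eval2 v1).
    have /andP[sA1 sB1] := short_eval2 x y z t u sv1.
    by apply/andP; split; rewrite (leq_trans (size_polyD _ _)) // geq_max size_polyN
      ?sA ?sB.
  apply: (exact1_reduced sw1); last first.
    have /and4P[? ? ? ?] := sv1.
    have := eval1_linear n x y z t u (-1) (eval2 v1) w.
    by rewrite w0 eval12 // scaler0 addr0 scaleN1r addrC.
  have /andP[_ sB1] := sw1.
  (* [G] collects the multiples of M discarded when C and E are divided by M; the bound on G * M
     forces it to be 0. *)
  pose G := Q + C0 * (z%:P - x *: 'X) + E0 * (t%:P - y *: 'X) - (lead2 n x y C1 E1)%:P.
  have DG : G * M = (w - eval2 v1).2.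
    rewrite /= -[w.2](subrK (Q * M)) DB DC DE /G -!mul_polyC; ring.
  by rewrite -DG (modulus_short sB1 DG) mul0r.
exists (v1 + v2); split.
  have /and4P[? ? ? ?] := sv1; have /and4P[? ? ? ?] := sv2.
  by apply/and4P; split; rewrite (leq_trans (size_polyD _ _)) // geq_max; apply/andP.
have := eval2_linear n x y z t u 1 v1 v2.
by rewrite !scale1r -Dv2 addrC subrK.
Qed.

Lemma eval2_sub v w : eval2 (w - v) = eval2 w - eval2 v.
Proof.
by have := eval2_linear n x y z t u (-1) v w; rewrite !scaleN1r ![- _ + _]addrC.
Qed.

Lemma exact2_reduced w : short2 n w -> w.2 = 0 -> eval2 w = 0 ->
  exists v, short3 n v /\ w = eval3 v.
Proof.
case: w => [[C E] W] /and4P[/= sC sE _ _] -> /(congr1 (fun c => c.1.2)) /=.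
rewrite /lead2 !coef0 !mulr0 addr0 scale0r subr0 => /koszul_G[s [DC DE]].
exists (s, 0); split; last first.
  by rewrite /eval3 /= coef0 !mulr0 !mul0r !scale0r !addr0 oppr0 -DC -DE.
rewrite /short3 /= size_poly0 andbT.
have [-> | s0] := eqVneq s 0; first by rewrite size_poly0.
(* As y is nonzero the degree is exactly 1, so s has one coefficient fewer than E. This is why the
   last module has n, not k, generators in its first block. *)
have size_lin : size (x%:P - y *: 'X : T) = 2%N.
  rewrite addrC size_polyDl size_polyN size_scale // size_polyX //.
  exact: leq_ltn_trans (size_polyC_leq1 _) _.
move: sE; rewrite DE size_polyN size_mul // ?lin_neq0 // size_lin.
by rewrite addnS addn1.
Qed.

(** Modulo M the pair z - x X, t - y X has only the Koszul syzygy. Since [pi] kills the first and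
    fixes the second, which is regular by [regt], the cofactor of t - y X is a multiple of z - x X
    modulo M; then [regz] determines the other cofactor. *)
Lemma exact2 w : short2 n w -> eval2 w = 0 -> exists v, short3 n v /\ w = eval3 v.
Proof.
move=> sw w0; have /and4P[sC' sE' sC sE] := sw.
have [pX px py pz pt] := pi_val.
have w2 : w.2.1 * (z%:P - x *: 'X) + w.2.2 * (t%:P - y *: 'X)
    + lead2 n x y w.2.1 w.2.2 *: M = 0 by exact: (congr1 snd w0).
have piM : pi M = M by rewrite /modulus !polyC_exp rmorphB !rmorphXn /= pX pi_u.
have [G DG] : exists G, pi w.2.2 = G * M.
  apply: (modulus_lin_reg (Q := - pi (lead2 n x y w.2.1 w.2.2)%:P) regt).
  apply/eqP; rewrite -subr_eq0; apply/eqP.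
  move: (M) piM w2 => m pim /(congr1 pi).
  rewrite rmorph0 -!mul_polyC !(rmorphD, rmorphN, rmorphM) /=.
  rewrite pX px py pz pt pim => <-; ring.
have [F DF] := pi_congr w.2.2.
have [H DH] : exists H, w.2.1 + F * (t%:P - y *: 'X) = H * M.
  apply: (modulus_lin_reg (Q := - (G * (t%:P - y *: 'X) + (lead2 n x y w.2.1 w.2.2)%:P))
    regz).
  apply/eqP; rewrite -subr_eq0 -w2 -[w.2.2](subrK (pi w.2.2)) DF DG -!mul_polyC.
  by apply/eqP; ring.
have [F0 [F1 [DF1 sF1]]] := modulus_div n u F.
(* The sign matches the Koszul part (D (t - y X), - D (z - x X)) in the second half of [eval3]. *)
pose v1 : row3 := (0, - F1).
have sv1 : short3 n v1 by rewrite /short3 /= size_poly0 size_polyN.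
have sv1' := short_eval3 x y z t u sv1.
have sw1 : short2 n (w - eval3 v1).
  have /and4P[? ? ? ?] := sv1'.
  by apply/and4P; split; rewrite (leq_trans (size_polyD _ _)) // geq_max size_polyN;
    apply/andP.
have v1P : eval2 (eval3 v1) = 0.
  by have /andP[? ?] := sv1; apply: eval23.
have w20 : (w - eval3 v1).2 = 0.
  have /and4P[_ _ s1 s2] := sw1.
  pose Q1 := H - F0 * (t%:P - y *: 'X) + (y * F1`_n)%:P.
  pose Q2 := G + F0 * (z%:P - x *: 'X) - (x * F1`_n)%:P.
  have D1 : Q1 * M = (w - eval3 v1).2.1.
    rewrite /= -[w.2.1](addrK (F * (t%:P - y *: 'X))) DH DF1 coefN /Q1 -!mul_polyC.
    rewrite mulrN polyCN; ring.
  have D2 : Q2 * M = (w - eval3 v1).2.2.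
    rewrite /= -[w.2.2](subrK (pi w.2.2)) DF DG DF1 coefN /Q2 -!mul_polyC.
    rewrite mulrN polyCN; ring.
  have Q10 := modulus_short s1 D1; have Q20 := modulus_short s2 D2.
  by rewrite [LHS]surjective_pairing -D1 -D2 Q10 Q20 !mul0r.
have [|v2 [sv2 Dv2]] := exact2_reduced sw1 w20.
  by rewrite eval2_sub w0 v1P subr0.
exists (v1 + v2); split.
  have /andP[? ?] := sv1; have /andP[? ?] := sv2.
  by apply/andP; split; rewrite (leq_trans (size_polyD _ _)) // geq_max; apply/andP.
have := eval3_linear n x y z t u 1 v1 v2.
by rewrite !scale1r -Dv2 addrC subrK.
Qed.

Lemma exact3 w : short3 n w -> eval3 w = 0 -> w = 0.
Proof.
case: w => [D' D] /andP[/= sD' sD] w0.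
have D0 : D = 0.
  have [Q DQ] : exists Q, D = Q * M.
    apply: (modulus_lin_reg (Q := - (y * D`_n)%:P) regt).
    have /eqP := congr1 (fun c => c.2.1) w0.
    by rewrite /= addr_eq0 => /eqP->; rewrite mulNr mul_polyC.
  by rewrite DQ (modulus_short sD (esym DQ)) mul0r.
have /eqP := congr1 (fun c => c.1.1) w0.
rewrite D0 /= coef0 scale0r addr0 mulf_eq0 (negPf (lin_neq0 _ t0)) orbF.
by move=> /eqP->.
Qed.

End Exactness.

Definition vec4 (A : Type) (a b c d : A) (i : 'I_4) : A := nth d [:: a; b; c] i.

Section Membership.
Variable A : comNzRingType.
Implicit Types a p q : A.

Lemma subrr_lin a p : exists C, a - a = C * p.
Proof. by exists 0; rewrite subrr mul0r. Qed.

Lemma self_lin p : exists C, p = C * p.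
Proof. by exists 1; rewrite mul1r. Qed.

Lemma subrr_lin2 a p q : exists C E, a - a = C * p + E * q.
Proof. by exists 0, 0; rewrite subrr !mul0r addr0. Qed.

Lemma left_lin2 p q : exists C E, p = C * p + E * q.
Proof. by exists 1, 0; rewrite mul1r mul0r addr0. Qed.

Lemma right_lin2 p q : exists C E, q = C * p + E * q.
Proof. by exists 0, 1; rewrite mul1r mul0r add0r. Qed.

End Membership.

(** The image of u = c x under [eta] is divisible by X, so at X = 0 only t^k remains. *)
Lemma eta_reg (R : idomainType) k (a y t : R) : t != 0 ->
  t%:P ^+ k - (a%:P * (y%:P * 'X)) ^+ 2 * y%:P ^+ k != 0.
Proof.
move=> t0; have : t ^+ k != 0 by rewrite expf_neq0.
apply: contra_neq => /(congr1 (horner_eval 0)).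
rewrite /horner_eval horner0 hornerD hornerN hornerM !horner_exp !hornerM.
by rewrite hornerX !hornerC !mulr0 expr0n mul0r subr0.
Qed.

(** * Exactness over K[x, y, z, t] *)

Section ConcreteExactness.
Variables (K : fieldType) (n : nat) (c : K).
Local Notation k := n.+1.
Local Notation S := {mpoly K[4]}.
Local Notation T := {poly S}.
Local Notation x := ('X_ix : S).
Local Notation y := ('X_iy : S).
Local Notation z := ('X_iz : S).
Local Notation t := ('X_it : S).
Local Notation u := (c%:MP * 'X_ix : S).

Let sigma := subst (vec4 x%:P y%:P (x%:P * 'X) (y%:P * 'X)).
Let eta := subst (vec4 (y%:P * 'X) y%:P (t%:P * 'X) t%:P).
Let theta := subst (vec4 (y%:P * 'X) y%:P z%:P t%:P).
Let pi := subst (vec4 x%:P y%:P (x%:P * 'X) t%:P).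
Let upsilon := subst (vec4 x%:P 0 z%:P t%:P).

Lemma mpolyXU_neq0 i : 'X_i != 0 :> S.
Proof. by rewrite -msupp_eq0 msuppX. Qed.

Lemma neq0_eval (v : 'I_4 -> K) (f : S) : f.@[v] != 0 -> f != 0.
Proof. by apply: contra_neq => ->; rewrite meval0. Qed.

Lemma meval_exp (v : 'I_4 -> K) (f : S) e : (f ^+ e).@[v] = f.@[v] ^+ e.
Proof. exact: (rmorphXn (meval v)). Qed.

Let sigma_val : [/\ sigma 'X = 'X, sigma x%:P = x%:P, sigma y%:P = y%:P,
  sigma z%:P = x%:P * 'X & sigma t%:P = y%:P * 'X].
Proof. by split; [exact: substX | exact: subst_var..]. Qed.

Let eta_val : [/\ eta 'X = 'X, eta x%:P = y%:P * 'X, eta y%:P = y%:P,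
  eta z%:P = t%:P * 'X & eta t%:P = t%:P].
Proof. by split; [exact: substX | exact: subst_var..]. Qed.

Let theta_val : [/\ theta 'X = 'X, theta x%:P = y%:P * 'X,
  theta y%:P = y%:P, theta z%:P = z%:P & theta t%:P = t%:P].
Proof. by split; [exact: substX | exact: subst_var..]. Qed.

Let pi_val : [/\ pi 'X = 'X, pi x%:P = x%:P,
  pi y%:P = y%:P, pi z%:P = x%:P * 'X & pi t%:P = t%:P].
Proof. by split; [exact: substX | exact: subst_var..]. Qed.

Let upsilon_y : upsilon y%:P = 0. Proof. exact: subst_var. Qed.
Let upsilon_t : upsilon t%:P = t%:P. Proof. exact: subst_var. Qed.

Let sigma_congr (P : T) : exists C E,
  P - sigma P = C * (z%:P - x *: 'X) + E * (t%:P - y *: 'X).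
Proof.
apply: subst_congr2; apply: forall_ord4; rewrite /vec4 /= -?mul_polyC.
- exact: subrr_lin2.
- exact: subrr_lin2.
- exact: left_lin2.
- exact: right_lin2.
Qed.

Let eta_congr (P : T) : exists C E,
  P - eta P = C * (x%:P - y *: 'X) + E * (z%:P - t *: 'X).
Proof.
apply: subst_congr2; apply: forall_ord4; rewrite /vec4 /= -?mul_polyC.
- exact: left_lin2.
- exact: subrr_lin2.
- exact: right_lin2.
- exact: subrr_lin2.
Qed.

Let theta_congr (P : T) : exists C, P - theta P = C * (x%:P - y *: 'X).
Proof.
apply: subst_congr1; apply: forall_ord4; rewrite /vec4 /= -?mul_polyC.
- exact: self_lin.
- exact: subrr_lin.
- exact: subrr_lin.
- exact: subrr_lin.
Qed.

Let pi_congr (P : T) : exists C, P - pi P = C * (z%:P - x *: 'X).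
Proof.
apply: subst_congr1; apply: forall_ord4; rewrite /vec4 /= -?mul_polyC.
- exact: subrr_lin.
- exact: subrr_lin.
- exact: self_lin.
- exact: subrr_lin.
Qed.

Let upsilon_congr (P : T) : exists C, P - upsilon P = C * y%:P.
Proof.
apply: subst_congr1; apply: forall_ord4; rewrite /vec4 /=.
- exact: subrr_lin.
- by exists 1; rewrite subr0 mul1r.
- exact: subrr_lin.
- exact: subrr_lin.
Qed.

Let sigma_u : sigma u%:P = u%:P.
Proof. by rewrite /sigma polyCM substM subst_const subst_var. Qed.

Let pi_u : pi u%:P = u%:P.
Proof. by rewrite /pi polyCM substM subst_const subst_var. Qed.

Let eta_u : t%:P ^+ k - eta u%:P ^+ 2 * y%:P ^+ k != 0.
Proof.
rewrite /eta polyCM substM subst_const subst_var.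
exact: eta_reg (mpolyXU_neq0 it).
Qed.

Let quad0 : quad x y z t != 0.
Proof.
apply: (@neq0_eval (vec4 1 0 0 1)).
by rewrite /quad mevalB !mevalM !mevalXU /= mulr1 mulr0 subr0 oner_eq0.
Qed.

Let regF : y ^+ n.+2 - u * x ^+ n.+2 != 0.
Proof.
apply: (@neq0_eval (vec4 0 1 0 0)).
rewrite mevalB (mevalM _ u) !meval_exp !mevalXU /vec4 /= expr0n mulr0 subr0.
by rewrite expr1n oner_eq0.
Qed.

Let regt : t ^+ k - y ^+ k * u ^+ 2 != 0.
Proof.
apply: (@neq0_eval (vec4 0 0 0 1)).
rewrite mevalB (mevalM _ (y ^+ k)) !meval_exp !mevalXU /vec4 /= expr0n mul0r subr0.
by rewrite expr1n oner_eq0.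
Qed.

Let regz : z ^+ k - x ^+ k * u ^+ 2 != 0.
Proof.
apply: (@neq0_eval (vec4 0 0 1 0)).
rewrite mevalB (mevalM _ (x ^+ k)) !meval_exp !mevalXU /vec4 /= expr0n mul0r subr0.
by rewrite expr1n oner_eq0.
Qed.

Definition D1 := diff1_mx n x y z t u.
Definition D2 := diff2_mx n x y z t u.
Definition D3 := diff3_mx n x y z t u.

Lemma exact_D1 (v : 'rV_(1 + k.+1 + k)) : v *m D1 = 0 <-> exists w : 'rV__, v = w *m D2.
Proof.
rewrite mul_diff_mx1 /diff1; split=> [/matrixP/(_ 0 0)|[w ->]].
  rewrite !mxE eqxx mulr1n => v0.
  have [w [sw Dw]] := exact1 sigma_val sigma_u sigma_congr eta_val eta_u eta_congr
    upsilon_y upsilon_t upsilon_congr (mpolyXU_neq0 iy) (mpolyXU_neq0 it)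
    quad0 regF (short_unpack1 v) v0.
  exists (pack2 n w); rewrite mul_diff_mx2 /diff2 pack2K //.
  by rewrite -Dw unpack1K.
rewrite mul_diff_mx2 /diff2 pack1K ?short_eval2 ?short_unpack2 //.
have /and4P[? ? ? ?] := short_unpack2 w.
by rewrite eval12 // raddf0.
Qed.

Lemma exact_D2 (v : 'rV_(k + k + (k + k))) :
  v *m D2 = 0 <-> exists w : 'rV__, v = w *m D3.
Proof.
rewrite mul_diff_mx2 /diff2; split=> [v0|[w ->]].
  have {}v0 : eval2 n x y z t u (unpack2 v) = 0.
    rewrite -[LHS](@pack1K _ n) ?short_eval2 ?short_unpack2 // v0.
    by rewrite /unpack1 !linear0 mxE.
  have [w [sw Dw]] := exact2 theta_val theta_congr pi_val pi_u pi_congr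
    (mpolyXU_neq0 iy) (mpolyXU_neq0 it) regt regz (short_unpack2 v) v0.
  exists (pack3 n w); rewrite mul_diff_mx3 /diff3 pack3K //.
  by rewrite -Dw unpack2K.
rewrite mul_diff_mx3 /diff3 pack2K ?short_eval3 ?short_unpack3 //.
have /andP[? ?] := short_unpack3 w.
rewrite eval23 // /pack1 /= !linear0 raddf0 !row_mx0 //.
Qed.

Lemma exact_D3 (v : 'rV_(n + k)) : v *m D3 = 0 -> v = 0.
Proof.
rewrite mul_diff_mx3 /diff3 => v0.
have {}v0 : eval3 n x y z t u (unpack3 v) = 0.
  rewrite -[LHS](@pack2K _ n) ?short_eval3 ?short_unpack3 // v0.
  by rewrite /unpack2 !linear0.
have {}v0 := exact3 (mpolyXU_neq0 it) regt (short_unpack3 v) v0.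
by rewrite -[v]unpack3K v0 /pack3 !linear0 row_mx0.
Qed.

End ConcreteExactness.

(** * The toric ideal and its tangent cone *)

Section StandardExponents.
Local Open Scope nat_scope.
Variable n : nat.
Local Notation k := n.+1.

Definition weight (a b c d : nat) : nat :=
  a * (k * k.+1) + b * (k * k.+2) + c * (k.+1 * k.+2) + d * (k.+1 * k.+2 + k).

Lemma weight_quad a b c d : weight a.+1 b c d.+1 = weight a b.+1 c.+1 d.
Proof. by rewrite /weight; lia. Qed.

Lemma weight_G a b c d i e : i + e = k ->
  weight (a + i + 2) (b + e) c d = weight a b (c + i) (d + e).
Proof.
by rewrite /weight => <-; lia.
Qed.

Lemma weight_F a b c j : j <= n ->
  weight (a + (n - j + 2)).+1 b (c + j) 0 = weight a (b + (n - j + 2)) c j.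
Proof.
by move=> /subnKC; rewrite /weight; move: (n - j) => e <-; lia.
Qed.

(** The monomials divisible by no y z, no z^i t^(k-i) and no y^(k+1-j) t^j with j < k. The exception
    b <= 1 reflects that y^(k+1-j) is at least y^2. *)
Definition std (a b c d : nat) : bool :=
  [&& (b == 0) || (c == 0), c + d < k & (b <= 1) || (b + d <= k)].

Lemma eq_modn_small m p q : p = q %[mod m] -> p < m -> q < m -> p = q.
Proof. by move=> e lp lq; rewrite -(modn_small lp) e modn_small. Qed.

Lemma eq_double_modn m p q : odd m -> p * 2 = q * 2 %[mod m] -> p = q %[mod m].
Proof.
move=> odd_m; wlog le_pq : p q / p <= q => [wl e|].
  by have [/wl|/ltnW/wl] := leqP p q; [|move/(_ (esym e))/esym] => // /(_ e).
move/esym/eqP; rewrite eqn_mod_dvd ?leq_mul2r ?le_pq // -mulnBl Gauss_dvdl.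
  by rewrite -eqn_mod_dvd // => /eqP.
by rewrite coprimen2.
Qed.

(* Modulo k + 1 the weight is - (b + d), modulo k it is 2 (c + d). *)
Lemma std_weight_inj a b c d a' b' c' d' : odd k ->
  std a b c d -> std a' b' c' d' -> weight a b c d = weight a' b' c' d' ->
  [/\ a = a', b = b', c = c' & d = d'].
Proof.
move=> odd_k /and3P[s1 s2 s3] /and3P[s1' s2' s3'] ww.
have mod_k1 p q r s : weight p q r s + (q + s) = 0 %[mod k.+1].
  rewrite (_ : _ + _ = (p * k + q * k.+1 + r * k.+2 + s * k.+3) * k.+1).
    by rewrite modnMl mod0n.
  by rewrite /weight; lia.
have mod_k p q r s : weight p q r s = (r + s) * 2 %[mod k].
  rewrite (_ : weight p q r s = (p * k.+1 + q * k.+2 + r * k.+3 + s * k.+4) * k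
    + (r + s) * 2); first by rewrite modnMDl.
  by rewrite /weight; lia.
have bd : b + d = b' + d'.
  (* For b <= 1, the bound b + d <= k comes from d < k. *)
  apply: (@eq_modn_small k.+1); [|lia|lia].
  apply/eqP; rewrite -(eqn_modDl (weight a b c d)); apply/eqP.
  by rewrite mod_k1 ww mod_k1.
have cd : c + d = c' + d'.
  apply: (@eq_modn_small k) => //; apply: (eq_double_modn odd_k).
  by rewrite -(mod_k a b) ww mod_k.
(* The two sums determine b - c, and b or c is 0 on either side. *)
have [eb ec ed] : [/\ b = b', c = c' & d = d'].
  by case/orP: s1 => /eqP ?; case/orP: s1' => /eqP ?; split; lia.
split=> //; move: ww; rewrite /weight eb ec ed => /addIn/addIn/addIn/eqP.
by rewrite eqn_pmul2r // => /eqP.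
Qed.

End StandardExponents.

Section Rewriting.
Variables (R : comNzRingType) (n : nat) (x y z t u : R).
Local Notation k := n.+1.
Local Notation row1 := (R^o * {poly R} * {poly R})%type.

(** The ideal of the generators, taken as the image of the first differential so that exactness at
    the augmentation is immediate. *)
Definition eideal (f : R) : Prop :=
  exists w : row1, short1 n w /\ f = eval1 n x y z t u w.

Lemma eideal0 : eideal 0.
Proof.
exists 0; split; first by rewrite /short1 /= size_poly0.
by rewrite /eval1 /= !heval0 !mulr0 !subrr mul0r !addr0.
Qed.

Lemma eideal_lin a f g : eideal f -> eideal g -> eideal (a * f + g).
Proof.
move=> [v [/andP[s1 s2] ->]] [w [/andP[s3 s4] ->]]; exists (a *: v + w); split.
  by apply/andP; split; rewrite (leq_trans (size_polyD _ _)) // geq_max;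
    apply/andP; split=> //; apply: leq_trans (size_scale_leq _ _) _.
by rewrite eval1_linear.
Qed.

Lemma eidealD f g : eideal f -> eideal g -> eideal (f + g).
Proof. by rewrite -{2}[f]mul1r; apply: eideal_lin. Qed.

Lemma eidealM a f : eideal f -> eideal (a * f).
Proof. by move=> If; rewrite -[_ * _]addr0; apply: eideal_lin eideal0. Qed.

Lemma eideal_sum (I : Type) (r : seq I) (P : pred I) (F : I -> R) :
  (forall i, P i -> eideal (F i)) -> eideal (\sum_(i <- r | P i) F i).
Proof. by move=> IF; elim/big_ind: _ => //; [exact: eideal0|exact: eidealD]. Qed.

Lemma eideal_quad : eideal (x * t - y * z).
Proof.
exists (1, 0, 0); split; first by rewrite /short1 /= size_poly0.
by rewrite /eval1 /= !heval0 !mulr0 !subrr mul1r !addr0.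
Qed.

Lemma eideal_G i : (i <= k)%N ->
  eideal (z ^+ i * t ^+ (k - i) - u ^+ 2 * (x ^+ i * y ^+ (k - i))).
Proof.
move=> le_ik; exists (0, 'X^i, 0); split.
  by rewrite /short1 /= size_poly0 size_polyXn ltnS le_ik.
by rewrite /eval1 /= !heval0 !heval_Xn // !mulr0 subrr mul0r add0r addr0.
Qed.

Lemma eideal_F j : (j <= n)%N ->
  eideal (y ^+ 2 * (t ^+ j * y ^+ (n - j)) - u * x ^+ 2 * (z ^+ j * x ^+ (n - j))).
Proof.
move=> le_jn; exists (0, 0, 'X^j); split.
  by rewrite /short1 /= size_poly0 size_polyXn ltnS le_jn.
by rewrite /eval1 /= !heval0 !heval_Xn // !mulr0 subrr mul0r !add0r.
Qed.

Definition mon a b c d : R := x ^+ a * y ^+ b * z ^+ c * t ^+ d.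

Lemma eideal_step_quad a b c d :
  eideal (mon a b.+1 c.+1 d - mon a.+1 b c d.+1).
Proof.
rewrite (_ : _ - _ = - mon a b c d * (x * t - y * z)).
  exact/eidealM/eideal_quad.
by rewrite /mon !exprS; ring.
Qed.

Lemma eideal_step_G a b c d i : (i <= k)%N ->
  eideal (mon a b (c + i) (d + (k - i))
    - u ^+ 2 * mon (a + i) (b + (k - i)) c d).
Proof.
move=> le_ik; rewrite (_ : _ - _ = mon a b c d *
  (z ^+ i * t ^+ (k - i) - u ^+ 2 * (x ^+ i * y ^+ (k - i)))).
  exact/eidealM/eideal_G.
by rewrite /mon !exprD; ring.
Qed.

Lemma eideal_step_F a b c d j : (j <= n)%N ->
  eideal (mon a (b + (n - j + 2)) c (d + j)
    - u * mon (a + (n - j + 2)) b (c + j) d).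
Proof.
move=> le_jn; rewrite (_ : _ - _ = mon a b c d *
  (y ^+ 2 * (t ^+ j * y ^+ (n - j)) - u * x ^+ 2 * (z ^+ j * x ^+ (n - j)))).
  exact/eidealM/eideal_F.
by rewrite /mon !exprD; ring.
Qed.

End Rewriting.

(** Every rewriting raises the exponent of x at constant weight, and the weight bounds this
    exponent. The quadric keeps the degree. For u = x, the g_i and f_j raise it by 2 and 1; for u =
    0 they are monomials and send the term to 0, whence the Boolean multiplicity. *)
Lemma std_reduction (R : comNzRingType) n (x y z t : R) a b c d :
  exists a' b' c' d', [/\ std n a' b' c' d',
    weight n a' b' c' d' = weight n a b c d,
    (a + b + c + d <= a' + b' + c' + d')%N,
    eideal n x y z t x (mon x y z t a b c d - mon x y z t a' b' c' d') &
    eideal n x y z t 0 (mon x y z t a b c d -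
      mon x y z t a' b' c' d' *+ (a' + b' + c' + d' == a + b + c + d)%N)].
Proof.
pose I1 := eideal n x y z t x; pose I0 := eideal n x y z t 0.
pose mo := mon x y z t.
suff H N : forall a b c d, (weight n a b c d < a + N)%N ->
  exists a' b' c' d', [/\ std n a' b' c' d',
    weight n a' b' c' d' = weight n a b c d,
    (a + b + c + d <= a' + b' + c' + d')%N, I1 (mo a b c d - mo a' b' c' d') &
    I0 (mo a b c d - mo a' b' c' d' *+ (a' + b' + c' + d' == a + b + c + d)%N)].
  by apply: (H (weight n a b c d).+1); rewrite addnS ltnS leq_addl.
elim: N => {a b c d} [|N IHN] a b c d w_lt.
  by move: w_lt; rewrite addn0 ltnNge /weight !mulnS -!addnA leq_addr.
have step a1 b1 c1 d1 : (a < a1)%N -> weight n a1 b1 c1 d1 = weight n a b c d ->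
    I1 (mo a b c d - mo a1 b1 c1 d1) ->
    (a + b + c + d <= a1 + b1 + c1 + d1)%N ->
    I0 (mo a b c d - mo a1 b1 c1 d1 *+ (a1 + b1 + c1 + d1 == a + b + c + d)%N) ->
  exists a' b' c' d', [/\ std n a' b' c' d',
    weight n a' b' c' d' = weight n a b c d,
    (a + b + c + d <= a' + b' + c' + d')%N, I1 (mo a b c d - mo a' b' c' d') &
    I0 (mo a b c d - mo a' b' c' d' *+ (a' + b' + c' + d' == a + b + c + d)%N)].
  move=> lt_a1 ww i1 le_deg i0.
  have [|a' [b' [c' [d' [s' w' le' i1' i0']]]]] := IHN a1 b1 c1 d1.
    by rewrite ww; lia.
  exists a', b', c', d'; split=> //; [by rewrite w'|exact: leq_trans le'| |].
    by rewrite -[_ - _](subrKA (mo a1 b1 c1 d1)); apply: eidealD.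
  (* If the first step raises the degree, the monomial itself lies in [I0], and later steps cannot
     bring the degree back. *)
  move: i0; case: eqVneq => [e i0|ne i0].
    by rewrite -e -[_ - _](subrKA (mo a1 b1 c1 d1)); apply: eidealD.
  by rewrite gtn_eqF // (leq_trans _ le') // ltn_neqAle eq_sym ne.
have [/andP[b0 c0]|nbc] := boolP ((0 < b) && (0 < c))%N.
  case: b c b0 c0 w_lt step => // b [//|c] _ _ w_lt step.
  apply: (step a.+1 b c d.+1); rewrite ?ltnSn //; first exact: weight_quad.
  - exact: eideal_step_quad.
  - by lia.
  - by rewrite (_ : _ == _); [exact: eideal_step_quad | apply/eqP; lia].
have [cd|cd] := leqP n.+1 (c + d).
  (* This choice makes z^i t^(k-i) divide z^c t^d. *)
  pose i := minn c n.+1.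
  have [le_ic le_in le_id] : [/\ i <= c, i <= n.+1 & n.+1 - i <= d]%N.
    by rewrite /i; split; lia.
  have := @eideal_step_G _ n x y z t x a b (c - i) (d - (n.+1 - i)) i le_in.
  have := @eideal_step_G _ n x y z t 0 a b (c - i) (d - (n.+1 - i)) i le_in.
  rewrite !subnK // expr0n mul0r => i0 i1.
  apply: (step (a + i + 2) (b + (n.+1 - i)) (c - i) (d - (n.+1 - i)))%N.
  - by lia.
  - by rewrite weight_G ?subnKC // !subnK.
  - rewrite /mo /mon addnC exprD -!mulrA; move: i1; by rewrite /mon !mulrA.
  - by lia.
  - by rewrite gtn_eqF ?subr0; [move: i0; rewrite subr0|lia].
have [bd|sbd] := boolP ((1 < b) && (n.+1 < b + d))%N.
  have [b1 bdn] := andP bd.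
  (* Now f_j applies with j = d: it uses up all of t^d together with y^(k+1-d). *)
  have le_dn : (d <= n)%N by lia.
  have := @eideal_step_F _ n x y z t x a (b - (n - d + 2)) c 0 d le_dn.
  have := @eideal_step_F _ n x y z t 0 a (b - (n - d + 2)) c 0 d le_dn.
  rewrite !subnK ?add0n ?mul0r => [i0 i1|]; last by lia.
  apply: (step (a + (n - d + 2)).+1 (b - (n - d + 2)) (c + d) 0)%N.
  - by lia.
  - by rewrite weight_F // subnK //; lia.
  - by move: i1; rewrite /mo /mon exprS -!mulrA.
  - by lia.
  - by rewrite gtn_eqF ?subr0; [move: i0; rewrite subr0|lia].
exists a, b, c, d; split=> //; last by rewrite eqxx subrr; apply: eideal0.
  by apply/and3P; split; lia.
by rewrite subrr; apply: eideal0.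
Qed.

Section WeightGrouping.

(** In the kernel of the map to K[s] coefficients sum to 0 in each weight; this carries the
    cancellation over to normal forms, which depend only on the weight. *)
Lemma grouped_sum0 (K : fieldType) (V : lmodType K) (I : finType) (wt : I -> nat)
    (cf : I -> K) (e : I -> V) :
    (forall w, \sum_(i | wt i == w) cf i = 0) ->
    (forall i j, wt i = wt j -> e i = e j) ->
  \sum_i cf i *: e i = 0.
Proof.
move=> cf0 e_wt; pose W := \max_i wt i.
have ltW i : (wt i < W.+1)%N by rewrite ltnS leq_bigmax.
rewrite (partition_big (fun i => Ordinal (ltW i)) xpredT) //= big1 // => w _.
have [i0 /eqP Di0|no_i] := pickP (fun i => Ordinal (ltW i) == w); last first.
  by rewrite big_pred0.
rewrite (eq_bigr (fun i => cf i *: e i0)) => [|i /eqP Di]; last first.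
  by rewrite (e_wt i i0) //; have := congr1 val Di; rewrite -Di0.
rewrite -scaler_suml (_ : \sum_(i | _) _ = 0) ?scale0r //.
by rewrite -[RHS](cf0 w); apply: eq_bigl => i; rewrite -val_eqE.
Qed.

End WeightGrouping.

Lemma big_ord4 (A : Type) (idx : A) (op : Monoid.law idx) (F : 'I_4 -> A) :
  \big[op/idx]_i F i = op (op (op (F ix) (F iy)) (F iz)) (F it).
Proof.
rewrite !big_ord_recr big_ord0 /= Monoid.mul1m.
by congr (op (op (op (F _) (F _)) (F _)) (F _)); apply: val_inj.
Qed.

Lemma morph_eval1 (R A : comNzRingType) n (x y z t u : R) (phi : {rmorphism R -> A}) w :
    phi x * phi t = phi y * phi z ->
    (forall i, (i <= n.+1)%N -> phi z ^+ i * phi t ^+ (n.+1 - i)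
      = phi u ^+ 2 * (phi x ^+ i * phi y ^+ (n.+1 - i))) ->
    (forall j, (j <= n)%N -> phi y ^+ 2 * (phi t ^+ j * phi y ^+ (n - j))
      = phi u * phi x ^+ 2 * (phi z ^+ j * phi x ^+ (n - j))) ->
  phi (eval1 n x y z t u w) = 0.
Proof.
move=> Q0 G0 F0.
have phiH m p q P : phi (heval m p q P)
    = \sum_(i < m.+1) phi P`_i * (phi p ^+ i * phi q ^+ (m - i)).
  rewrite /heval rmorph_sum; apply: eq_bigr => i _.
  by rewrite !rmorphM !rmorphXn.
rewrite /eval1 /quad !(rmorphD, rmorphN, rmorphXn, rmorphM) /= Q0 subrr mulr0 add0r.
rewrite !phiH !mulr_sumr -!sumrB !big1 ?addr0 // => i _.
  by rewrite mulrCA [X in _ - X]mulrCA -mulrBr F0 ?subrr ?mulr0 // -ltnS.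
by rewrite [X in _ - X]mulrCA -mulrBr G0 ?subrr ?mulr0 // -ltnS.
Qed.

Section Ideals.
Variables (K : fieldType) (n : nat) (b : 'I_4 -> nat).
Local Notation k := n.+1.
Local Notation S := {mpoly K[4]}.
Local Notation x := ('X_ix : S).
Local Notation y := ('X_iy : S).
Local Notation z := ('X_iz : S).
Local Notation t := ('X_it : S).

Hypothesis odd_k : odd k.
Hypothesis b_val : [/\ b ix = (k * k.+1)%N, b iy = (k * k.+2)%N,
  b iz = (k.+1 * k.+2)%N & b it = (k.+1 * k.+2 + k)%N].

Let psi := mmap (@polyC K) (fun i => 'X^(b i)) : S -> {poly K}.
Let mo := mon x y z t.
Let wt (m : 'X_{1..4}) := weight n (m ix) (m iy) (m iz) (m it).

Lemma mpolyX_mon (m : 'X_{1..4}) : 'X_[m] = mo (m ix) (m iy) (m iz) (m it).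
Proof.
by rewrite mpolyXE_id big_ord4.
Qed.

Lemma mdeg_sum4 (m : 'X_{1..4}) : mdeg m = (m ix + m iy + m iz + m it)%N.
Proof.
by rewrite mdegE big_ord4.
Qed.

Let psiM p q : psi (p * q) = psi p * psi q.
Proof. exact: (rmorphM (mmap _ _)). Qed.
Let psiX p e : psi (p ^+ e) = psi p ^+ e.
Proof. exact: (rmorphXn (mmap _ _)). Qed.
Let psi_sum (I : Type) (r : seq I) (P : pred I) (F : I -> S) :
  psi (\sum_(i <- r | P i) F i) = \sum_(i <- r | P i) psi (F i).
Proof. exact: (raddf_sum (mmap _ _)). Qed.

Lemma psi_var i : psi 'X_i = 'X^(b i).
Proof. by rewrite /psi mmapX mmap1U. Qed.

Lemma psi_mon a1 a2 a3 a4 : psi (mo a1 a2 a3 a4) = 'X^(weight n a1 a2 a3 a4).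
Proof.
have [bx by_ bz bt] := b_val.
rewrite /mo /mon !psiM !psiX !psi_var -!exprM -!exprD bx by_ bz bt /weight.
by congr ('X^_); lia.
Qed.

Lemma eideal_toric f : eideal n x y z t x f -> toric_ideal K b f.
Proof.
have [bx by_ bz bt] := b_val.
have Xexp (p q : nat) : p = q -> 'X^p = 'X^q :> {poly K} by move->.
case=> w [_ ->]; apply: (@morph_eval1 _ _ _ _ _ _ _ _ psi) => [|i|j].
- rewrite -[LHS]/(psi x * psi t) -[RHS]/(psi y * psi z).
  rewrite !psi_var -!exprD; apply: Xexp; rewrite bx by_ bz bt; lia.
- move/subnKC; rewrite -[X in _ -> X = _]/(psi z ^+ i * psi t ^+ (k - i)).
  rewrite -[X in _ -> _ = X]/(psi x ^+ 2 * (psi x ^+ i * psi y ^+ (k - i))).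
  rewrite !psi_var -!exprM -!exprD => De; apply: Xexp.
  by rewrite bx by_ bz bt; move: (k - i)%N De => e <-; lia.
- move/subnKC.
  rewrite -[X in _ -> X = _]/(psi y ^+ 2 * (psi t ^+ j * psi y ^+ (n - j))).
  rewrite -[X in _ -> _ = X]/(psi x * psi x ^+ 2 * (psi z ^+ j * psi x ^+ (n - j))).
  rewrite !psi_var -!exprM -!exprD => De; apply: Xexp.
  by rewrite bx by_ bz bt; move: (n - j)%N De => e <-; lia.
Qed.

Lemma toric_coef0 f w : toric_ideal K b f ->
  \sum_(m <- msupp f | wt m == w) f@_m = 0.
Proof.
move=> If; transitivity (psi f)`_w; last by rewrite [psi f]If coef0.
rewrite [in RHS](mpolyE f) psi_sum coef_sum big_mkcond.
apply: eq_bigr => m _; rewrite [psi _]mmapZ -/psi mpolyX_mon psi_mon coefCM coefXn.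
by rewrite eq_sym; case: eqP => _; rewrite ?mulr1 ?mulr0.
Qed.

Local Notation supp f i := (tnth (in_tuple (msupp f)) i).

(** Independence of the monomial within its weight is [std_weight_inj]. Indexing by positions in the
    support makes the choice of normal forms finite. *)
Lemma standard_monomials (f : S) :
  exists (g : 'I_(size (msupp f)) -> S) (dg : 'I_(size (msupp f)) -> nat),
  [/\ forall i, eideal n x y z t x ('X_[supp f i] - g i),
      forall i, (mdeg (supp f i) <= dg i)%N,
      forall i, eideal n x y z t 0 ('X_[supp f i] - g i *+ (dg i == mdeg (supp f i))) &
      forall i j, wt (supp f i) = wt (supp f j) -> g i = g j /\ dg i = dg j].
Proof.
pose P i (e : nat * nat * nat * nat) :=
  let: (a1, a2, a3, a4) := e in let d := (a1 + a2 + a3 + a4)%N in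
  [/\ std n a1 a2 a3 a4, weight n a1 a2 a3 a4 = wt (supp f i), (mdeg (supp f i) <= d)%N,
   eideal n x y z t x ('X_[supp f i] - mo a1 a2 a3 a4) &
   eideal n x y z t 0 ('X_[supp f i] - mo a1 a2 a3 a4 *+ (d == mdeg (supp f i)))].
have [|r rP] := @fin_all_exists _ _ P.
  move=> i; have [a1 [a2 [a3 [a4 r_i]]]] :=
    std_reduction n x y z t (supp f i ix) (supp f i iy) (supp f i iz) (supp f i it).
  by exists (a1, a2, a3, a4); rewrite /P mdeg_sum4 mpolyX_mon.
exists (fun i => let: (a1, a2, a3, a4) := r i in mo a1 a2 a3 a4).
exists (fun i => let: (a1, a2, a3, a4) := r i in (a1 + a2 + a3 + a4)%N).
split=> [i|i|i|i j ww].
- by have := rP i; case: (r i) => [[[a1 a2] a3] a4] [_ _ _ r1 _]; exact: r1.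
- by have := rP i; case: (r i) => [[[a1 a2] a3] a4] [_ _ r1 _ _]; exact: r1.
- by have := rP i; case: (r i) => [[[a1 a2] a3] a4] [_ _ _ _ r1]; exact: r1.
have := rP i; have := rP j.
case: (r i) => [[[a1 a2] a3] a4]; case: (r j) => [[[c1 c2] c3] c4].
move=> [sc wc _ _ _] [sa wa _ _ _].
by have [| -> -> -> ->] := std_weight_inj odd_k sa sc; first by rewrite wa wc.
Qed.

Lemma mpoly_sum_ord (f : S) (P : pred 'X_{1..4}) :
  \sum_(m <- msupp f | P m) f@_m *: 'X_[m] = \sum_(i < size (msupp f) |
    P (supp f i)) f@_(supp f i)
      *: 'X_[supp f i] :> S.
Proof. by rewrite [LHS]big_tnth. Qed.

Lemma toric_grouped (f : S) (e : 'I_(size (msupp f)) -> S) : toric_ideal K b f ->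
    (forall i j, wt (supp f i) = wt (supp f j)
      -> e i = e j) ->
  \sum_i f@_(supp f i) *: e i = 0.
Proof.
move=> If; apply: grouped_sum0 => w.
by rewrite -[RHS](toric_coef0 w If) [RHS]big_tnth.
Qed.

(** The normal forms of the terms of f cancel, so f is a combination of differences between
    monomials and their normal forms. *)
Lemma toric_eideal f : toric_ideal K b f -> eideal n x y z t x f.
Proof.
move=> If; have [g [dg [g1 _ _ g_wt]]] := standard_monomials f.
rewrite [f]mpolyE mpoly_sum_ord /=.
rewrite -[\sum_(i < _) _]subr0.
rewrite -[X in _ - X](toric_grouped If (fun i j ww => (g_wt i j ww).1)).
rewrite -sumrB; apply: eideal_sum => i _.
by rewrite -scalerBr -mul_mpolyC; apply/eidealM/g1.
Qed.

(** Keeping only the normal forms of the lowest degree d preserves the cancellation in each weight.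
    Terms of f of degree above d have normal forms of degree above d, so only terms of degree d
    remain, each congruent for u = 0 to its kept normal form or to 0. *)
Lemma initial_eideal (f : S) : f != 0 -> toric_ideal K b f ->
  eideal n x y z t 0 (initial_form f).
Proof.
move=> f0 If; have [g [dg [_ le_dg g0 g_wt]]] := standard_monomials f.
rewrite /initial_form pihomogE mpoly_sum_ord /=; set d := mdeg (mlast f).
have e_wt i j : wt (supp f i) = wt (supp f j) ->
    g i *+ (dg i == d) = g j *+ (dg j == d).
  by move=> /g_wt[-> ->].
rewrite -[\sum_(i < _ | _) _]subr0 -[X in _ - X](toric_grouped If e_wt).
rewrite [X in _ - X](bigID (fun i => mdeg (supp f i) == d)) /=.
rewrite [X in _ - (_ + X)]big1 ?addr0 => [|i ne_d]; last first.
  rewrite gtn_eqF ?scaler0 //; apply: leq_trans (le_dg i).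
  by rewrite ltn_neqAle eq_sym ne_d lemc_mdeg // mlast_lemc // mem_tnth.
rewrite -sumrB; apply: eideal_sum => i /eqP di.
by rewrite -scalerBr -mul_mpolyC -[in dg i == d]di; apply/eidealM/g0.
Qed.

End Ideals.

(** * Weighted homogeneity and initial forms *)

Section Homogeneous.
Variables (m : nat) (K : fieldType) (w : 'I_m -> nat).
Implicit Types (f g : {mpoly K[m]}) (d e : int).

Definition whomog d f : Prop :=
  forall a, a \in msupp f -> (\sum_l a l * w l)%N%:Z = d.

Lemma whomog0 d : whomog d 0.
Proof. by move=> a; rewrite msupp0. Qed.

Lemma whomogC c : whomog 0 c%:MP.
Proof.
move=> a; rewrite msuppC; case: ifP => // _; rewrite inE => /eqP->.
by rewrite big1 // => l _; rewrite mnm0E.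
Qed.

Lemma whomogX i : whomog (w i)%:Z 'X_i.
Proof.
move=> a; rewrite msuppX inE => /eqP->; rewrite (bigD1 i) //= big1 => [|j ij].
  by rewrite mnm1E eqxx mul1n addn0.
by rewrite mnm1E eq_sym (negPf ij).
Qed.

Lemma whomogD d f g : whomog d f -> whomog d g -> whomog d (f + g).
Proof.
by move=> hf hg a /msuppD_le; rewrite mem_cat => /orP[/hf|/hg].
Qed.

Lemma whomogN d f : whomog d f -> whomog d (- f).
Proof. by move=> hf a; rewrite (perm_mem (msuppN f)) => /hf. Qed.

Lemma whomogM d e f g : whomog d f -> whomog e g -> whomog (d + e) (f * g).
Proof.
move=> hf hg a /msuppM_le /allpairsP[[a1 a2] /= [/hf<- /hg<- ->]].
rewrite -PoszD -big_split; congr Posz; apply: eq_bigr => l _.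
by rewrite mnmDE mulnDl.
Qed.

Lemma whomogXn d f i : whomog d f -> whomog (i%:Z * d) (f ^+ i).
Proof.
move=> hf; elim: i => [|i IHi].
  by rewrite expr0 mul0r -mpolyC1; apply: whomogC.
by rewrite exprS intS mulrDl mul1r; apply: whomogM.
Qed.

Lemma whomog_sum (I : Type) (r : seq I) (P : pred I) (F : I -> {mpoly K[m]}) d :
  (forall i, P i -> whomog d (F i)) -> whomog d (\sum_(i <- r | P i) F i).
Proof. by move=> hF; elim/big_ind: _ => //; [exact: whomog0|exact: whomogD]. Qed.

Lemma whomog_eq d e f : whomog d f -> d = e -> whomog e f.
Proof. by move=> hf <-. Qed.

End Homogeneous.

Section GenIdeal.
Variables (m : nat) (K : fieldType) (G : {mpoly K[m]} -> Prop).

Lemma gen_ideal_gen c g : G g -> gen_ideal G (c * g).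
Proof.
move=> Gg; exists 1%N, (fun=> c), (fun=> g); split=> //.
by rewrite big_ord1.
Qed.

Lemma gen_ideal0 : gen_ideal G 0.
Proof. by exists 0%N, (fun=> 0), (fun=> 0); split=> [[]//|]; rewrite big_ord0. Qed.

Lemma gen_idealD f g : gen_ideal G f -> gen_ideal G g -> gen_ideal G (f + g).
Proof.
move=> [k1 [c1 [g1 [G1 ->]]]] [k2 [c2 [g2 [G2 ->]]]]; exists (k1 + k2)%N.
exists (fun i => match split i with inl j => c1 j | inr j => c2 j end).
exists (fun i => match split i with inl j => g1 j | inr j => g2 j end).
split=> [i|]; first by case: (split i).
rewrite big_split_ord; congr (_ + _); apply: eq_bigr => i _.
  by rewrite (unsplitK (inl i)).
by rewrite (unsplitK (inr i)).
Qed.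

Lemma gen_ideal_sum (I : Type) (r : seq I) (P : pred I) (F : I -> {mpoly K[m]}) :
  (forall i, P i -> gen_ideal G (F i)) -> gen_ideal G (\sum_(i <- r | P i) F i).
Proof. by move=> IF; elim/big_ind: _ => //; [exact: gen_ideal0|exact: gen_idealD]. Qed.

End GenIdeal.

Lemma initial_form_split m (K : fieldType) (p r : {mpoly K[m]}) d e :
    p != 0 -> whomog (fun=> 1%N) d p -> whomog (fun=> 1%N) e r -> d < e ->
  initial_form (p + r) = p /\ p + r != 0.
Proof.
move=> p0 hp hr lt_de.
have mdegZ (a : 'X_{1..m}) : (\sum_l a l * 1)%N = mdeg a.
  by rewrite mdegE; apply: eq_bigr => l _; rewrite muln1.
have [a pa] : exists a, a \in msupp p.
  by move: p0; rewrite -msupp_eq0; case: (msupp p) => // a s; exists a; rewrite inE eqxx.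
have da : (mdeg a)%:Z = d by rewrite -mdegZ hp.
have fa : a \in msupp (p + r).
  rewrite mcoeff_msupp mcoeffD [r@_a]memN_msupp_eq0 ?addr0 -?mcoeff_msupp //.
  by apply/negP => /hr; rewrite mdegZ da => De; rewrite De ltxx in lt_de.
have f0 : p + r != 0 by rewrite -msupp_eq0; case: (msupp _) fa.
split=> //; have dl : (mdeg (mlast (p + r)))%:Z = d.
  have le_a : (mdeg (mlast (p + r)))%:Z <= d.
    by rewrite -da lez_nat lemc_mdeg // mlast_lemc.
  have := msuppD_le (mlast_supp f0); rewrite mem_cat => /orP[/hp|/hr]; rewrite mdegZ //.
  by move=> De; rewrite De leNgt lt_de in le_a.
rewrite /initial_form pihomogD pihomog_dE; last first.
  by apply/dhomogP => c /hp; rewrite mdegZ -dl => -[].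
rewrite pihomogE big1_seq ?addr0 // => c /andP[/eqP dc /hr].
by rewrite mdegZ dc dl => De; rewrite De ltxx in lt_de.
Qed.

Section TangentCone.
Variables (K : fieldType) (n : nat) (b : 'I_4 -> nat).
Local Notation k := n.+1.
Local Notation S := {mpoly K[4]}.
Local Notation x := ('X_ix : S).
Local Notation y := ('X_iy : S).
Local Notation z := ('X_iz : S).
Local Notation t := ('X_it : S).

Hypothesis odd_k : odd k.
Hypothesis b_val : [/\ b ix = (k * k.+1)%N, b iy = (k * k.+2)%N,
  b iz = (k.+1 * k.+2)%N & b it = (k.+1 * k.+2 + k)%N].

Local Notation initial := (fun g : S => exists f,
  [/\ f != 0, toric_ideal K b f & g = initial_form f]).

Lemma initial_split p r d e : p != 0 ->
    whomog (fun=> 1%N) d p -> whomog (fun=> 1%N) e r -> d < e ->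
    eideal n x y z t x (p - r) -> initial p.
Proof.
move=> p0 hp hr lt_de /(eideal_toric odd_k b_val) If.
have [ip f0] := initial_form_split p0 hp (whomogN hr) lt_de.
by exists (p - r).
Qed.

(** From right to left, each generator for u = 0 is the initial form of its counterpart for u = x:
    the tail is absent for the quadric and has larger degree for the others. *)
Lemma tangent_eideal f :
  tangent_cone_ideal (toric_ideal K b) f <-> eideal n x y z t 0 f.
Proof.
split=> [[N [c [g [Gg ->]]]]|].
  apply: eideal_sum => i _; apply: eidealM.
  by have [h [h0 Ih ->]] := Gg i; apply: (initial_eideal odd_k b_val).
have h1 i : whomog (fun=> 1%N) 1 ('X_i : S) by exact: whomogX.
case=> [[[a A] B] [_ ->]]; rewrite /eval1 expr0n !mul0r !subr0 /=.
apply: gen_idealD; first apply: gen_idealD.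
- apply: gen_ideal_gen; apply: (@initial_split _ 0 2 3) => //.
  + apply: (@neq0_eval _ (vec4 1 0 0 1)).
    by rewrite /quad mevalB !mevalM !mevalXU /= mulr1 mulr0 subr0 oner_eq0.
  + by apply: whomogD; [|apply: whomogN]; apply: (whomogM (h1 _) (h1 _)).
  + exact: whomog0.
  + by rewrite subr0; apply: eideal_quad.
- apply: gen_ideal_sum => i _; apply: gen_ideal_gen.
  have le_ik : (i <= k)%N by rewrite -ltnS.
  apply: (@initial_split _ _ (i%:Z * 1 + (k - i)%N%:Z * 1)
    (2%:Z * 1 + (i%:Z * 1 + (k - i)%N%:Z * 1)) _ _ _ _ (eideal_G x y z t x le_ik)).
  + by rewrite mulf_neq0 ?expf_neq0 ?mpolyXU_neq0.
  + by do ?[apply: whomogM | apply: whomogXn]; apply: h1.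
  + by do ?[apply: whomogM | apply: whomogXn]; apply: h1.
  + by lia.
- rewrite mulr_sumr; apply: gen_ideal_sum => j _; rewrite mulrCA; apply: gen_ideal_gen.
  have le_jn : (j <= n)%N by rewrite -ltnS.
  apply: (@initial_split _ _ (2%:Z * 1 + (j%:Z * 1 + (n - j)%N%:Z * 1))
    (1 + 2%:Z * 1 + (j%:Z * 1 + (n - j)%N%:Z * 1)) _ _ _ _ (eideal_F x y z t x le_jn)).
  + by rewrite !mulf_neq0 ?expf_neq0 ?mpolyXU_neq0.
  + by do ?[apply: whomogM | apply: whomogXn]; apply: h1.
  + by do ?[apply: whomogM | apply: whomogXn]; apply: h1.
  + by lia.
Qed.

End TangentCone.

(** * Grading and minimality *)

Section GradedPolynomials.
Variables (m : nat) (K : fieldType) (w : 'I_m -> nat).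
Local Notation S := {mpoly K[m]}.
Local Notation whomog := (@whomog m K w).

(* Homogeneity of degree d in [{poly S}], where 'X is given the weight - e. *)
Definition pgraded (d e : int) (P : {poly S}) : Prop :=
  forall i : nat, whomog (d + e * i%:Z) P`_i.

Lemma pgraded_eq d d' e P : pgraded d e P -> d = d' -> pgraded d' e P.
Proof. by move=> hP <-. Qed.

Lemma pgradedD d e P Q : pgraded d e P -> pgraded d e Q -> pgraded d e (P + Q).
Proof. by move=> hP hQ i; rewrite coefD; apply: whomogD. Qed.

Lemma pgradedN d e P : pgraded d e P -> pgraded d e (- P).
Proof. by move=> hP i; rewrite coefN; apply: whomogN. Qed.

Lemma pgradedC d e a : whomog d a -> pgraded d e a%:P.
Proof.
move=> ha [|i]; rewrite coefC /=; first by rewrite mulr0 addr0.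
exact: whomog0.
Qed.

Lemma pgradedXn e i : pgraded (- (e * i%:Z)) e 'X^i.
Proof.
move=> j; rewrite coefXn; case: eqP => [->|_]; last exact: whomog0.
by rewrite addNr -mpolyC1; apply: whomogC.
Qed.

Lemma pgradedM d d' e P Q :
  pgraded d e P -> pgraded d' e Q -> pgraded (d + d') e (P * Q).
Proof.
move=> hP hQ i; rewrite coefM; apply: whomog_sum => j _.
apply: whomog_eq (whomogM (hP j) (hQ (i - j)%N)) _.
move: (subnKC (ltnSE (ltn_ord j))); move: (i - j)%N (nat_of_ord j) => l j1 <-.
by lia.
Qed.

Lemma pgradedZ d d' e a P : whomog d a -> pgraded d' e P -> pgraded (d + d') e (a *: P).
Proof. by move=> ha hP; rewrite -mul_polyC; apply/pgradedM/hP/pgradedC. Qed.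

Lemma pgraded_lin d e d' (a c : S) : whomog d a -> whomog d' c -> d' - e = d ->
  pgraded d e (a%:P - c *: 'X).
Proof.
move=> ha hc De; apply: pgradedD; first exact: pgradedC.
have hX : pgraded (- e) e 'X by rewrite -[e in - e]mulr1 -['X]expr1; apply: pgradedXn.
by apply: pgradedN; apply: pgraded_eq (pgradedZ hc hX) De.
Qed.

(** The choice e = dq - dp gives all the products P_j p^j q^(i-j) the same weight. *)
Lemma whomog_heval d e (p q : S) dp dq i P :
    pgraded d e P -> whomog dp p -> whomog dq q -> e = dq - dp ->
  whomog (d + i%:Z * dq) (heval i p q P).
Proof.
move=> hP hp hq De; apply: whomog_sum => j _.
apply: (@whomog_eq _ _ _ (d + e * j%:Z + (j%:Z * dp + (i - j)%N%:Z * dq))).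
  by apply: whomogM; [exact: hP|apply: whomogM; apply: whomogXn].
rewrite De; move: (subnKC (ltnSE (ltn_ord j))); move: (i - j)%N (nat_of_ord j) => l j1 <-.
by lia.
Qed.

Definition hrow p (sh : 'I_p -> int) (d : int) (v : 'rV[S]_p) : Prop :=
  forall j, whomog (d - sh j) (v 0 j).

Definition shift_cat p q (s1 : 'I_p -> int) (s2 : 'I_q -> int) (i : 'I_(p + q)) :=
  match split i with inl j => s1 j | inr j => s2 j end.

Lemma hrow_row_mx p q s1 s2 d (v1 : 'rV[S]_p) (v2 : 'rV[S]_q) :
  hrow s1 d v1 -> hrow s2 d v2 -> hrow (shift_cat s1 s2) d (row_mx v1 v2).
Proof.
move=> h1 h2 j; rewrite mxE /shift_cat; case: (split j) => i; [exact: h1|exact: h2].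
Qed.

Lemma hrow_lsubmx p q s1 s2 d (v : 'rV[S]_(p + q)) :
  hrow (shift_cat s1 s2) d v -> hrow s1 d (lsubmx v).
Proof.
move=> h j; rewrite mxE; have := h (lshift q j).
by rewrite /shift_cat (unsplitK (inl j)).
Qed.

Lemma hrow_rsubmx p q s1 s2 d (v : 'rV[S]_(p + q)) :
  hrow (shift_cat s1 s2) d v -> hrow s2 d (rsubmx v).
Proof.
move=> h j; rewrite mxE; have := h (rshift p j).
by rewrite /shift_cat (unsplitK (inr j)).
Qed.

Lemma hrow_delta p s (r : 'I_p) : hrow s (s r) (delta_mx 0 r : 'rV[S]_p).
Proof.
move=> j; rewrite mxE eqxx /=; case: eqP => [->|_]; last exact: whomog0.
by rewrite subrr -mpolyC1; apply: whomogC.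
Qed.

Definition shift_lin p (s e : int) (i : 'I_p) : int := s - e * i%:Z.

Lemma hrow_poly_rV p s e d P :
  pgraded (d - s) e P -> hrow (@shift_lin p s e) d (poly_rV P).
Proof.
by move=> hP j; rewrite mxE; apply: whomog_eq (hP j) _; rewrite /shift_lin; ring.
Qed.

Lemma pgraded_rVpoly p s e d v :
  hrow (@shift_lin p s e) d v -> pgraded (d - s) e (rVpoly v).
Proof.
move=> hv i; rewrite coef_rVpoly; case: insubP => [j _ <-|_]; last exact: whomog0.
by apply: whomog_eq (hv j) _; rewrite /shift_lin; ring.
Qed.

End GradedPolynomials.

Section Minimality.
Variables (m : nat) (K : fieldType).
Local Notation S := {mpoly K[m]}.

Definition nconst (f : S) : Prop := f@_0 = 0.

Lemma nconst0 : nconst 0. Proof. exact: mcoeff0. Qed.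

Lemma nconstD f g : nconst f -> nconst g -> nconst (f + g).
Proof. by rewrite /nconst mcoeffD => -> ->; rewrite addr0. Qed.

Lemma nconstN f : nconst f -> nconst (- f).
Proof. by rewrite /nconst mcoeffN => ->; rewrite oppr0. Qed.

Lemma nconstM f g : nconst f -> nconst (f * g).
Proof. by rewrite /nconst => f0; rewrite [LHS](rmorphM (mcoeff 0)) /= f0 mul0r. Qed.

Lemma nconstMr f g : nconst g -> nconst (f * g).
Proof. by rewrite mulrC; apply: nconstM. Qed.

Lemma nconstX i : nconst 'X_i.
Proof. by rewrite /nconst mcoeffX mnm1_eq0. Qed.

Lemma nconst_sum (I : Type) (r : seq I) (P : pred I) (F : I -> S) :
  (forall i, P i -> nconst (F i)) -> nconst (\sum_(i <- r | P i) F i).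
Proof. by move=> IF; elim/big_ind: _ => //; [exact: nconst0|exact: nconstD]. Qed.

Lemma nconst_heval i (p q : S) P : nconst p -> nconst q -> nconst (heval i.+1 p q P).
Proof.
move=> hp hq; apply: nconst_sum => j _; apply: nconstMr.
have [j0|j0] := posnP j; first by rewrite j0 subn0 expr0 mul1r exprS; apply: nconstM.
by rewrite -(prednK j0) exprS -mulrA; apply: nconstM.
Qed.

Definition pnconst (P : {poly S}) : Prop := forall i : nat, nconst P`_i.

Lemma pnconstD P Q : pnconst P -> pnconst Q -> pnconst (P + Q).
Proof. by move=> hP hQ i; rewrite coefD; apply: nconstD. Qed.

Lemma pnconstN P : pnconst P -> pnconst (- P).
Proof. by move=> hP i; rewrite coefN; apply: nconstN. Qed.

Lemma pnconstM P Q : pnconst Q -> pnconst (P * Q).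
Proof. by move=> hQ i; rewrite coefM; apply: nconst_sum => j _; apply: nconstMr. Qed.

Lemma pnconstC a : nconst a -> pnconst a%:P.
Proof. by move=> ha i; rewrite coefC; case: ifP => // _; apply: nconst0. Qed.

Lemma pnconstZ a P : nconst a -> pnconst (a *: P).
Proof. by move=> ha i; rewrite coefZ; apply: nconstM. Qed.

Lemma pnconstZr a P : pnconst P -> pnconst (a *: P).
Proof. by move=> hP i; rewrite coefZ; apply: nconstMr. Qed.

Lemma pnconst_lin a c i : nconst a -> nconst c -> pnconst (a%:P - c *: 'X^i).
Proof.
by move=> ha hc; apply: pnconstD (pnconstC ha) _; apply/pnconstN/pnconstZ.
Qed.

End Minimality.

Section GradedDifferentials.
Variables (K : fieldType) (n : nat) (w : 'I_4 -> nat) (u : {mpoly K[4]}).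
Local Notation k := n.+1.
Local Notation S := {mpoly K[4]}.
Local Notation x := ('X_ix : S).
Local Notation y := ('X_iy : S).
Local Notation z := ('X_iz : S).
Local Notation t := ('X_it : S).
Local Notation wx := ((w ix)%:Z).
Local Notation wy := ((w iy)%:Z).
Local Notation wz := ((w iz)%:Z).
Local Notation wt := ((w it)%:Z).

Hypothesis hw : wx + wt = wy + wz.
Hypothesis hu : whomog w (n.+2%:Z * (wy - wx)) u.
Hypothesis hu2 : whomog w (k%:Z * (wz - wx)) (u ^+ 2).

(** The slopes [wt - wz] and [wx - wz] are minus the weights of X = z/t on the g_i and of X = z/x on
    the f_j. *)
Definition shift1 : 'I_(1 + k.+1 + k) -> int :=
  shift_cat (shift_cat (fun=> wx + wt) (shift_lin (k%:Z * wt) (wt - wz)))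
    (shift_lin (n.+2%:Z * wy) (wx - wz)).

Definition shift2 : 'I_(k + k + (k + k)) -> int :=
  shift_cat
    (shift_cat (shift_lin (wx + k%:Z * wt) (wt - wz))
       (shift_lin (wz + k%:Z * wt) (wt - wz)))
    (shift_cat (shift_lin (wz + n.+2%:Z * wy) (wx - wz))
       (shift_lin (wt + n.+2%:Z * wy) (wx - wz))).

Definition shift3 : 'I_(n + k) -> int :=
  shift_cat (shift_lin (wz + wx + k%:Z * wt) (wt - wz))
    (shift_lin (wt + wz + n.+2%:Z * wy) (wx - wz)).

Let hX i : whomog w (w i)%:Z ('X_i : S) := @whomogX _ K w i.
Arguments hX : clear implicits.
Let hXn i e : whomog w (e%:Z * (w i)%:Z) ('X_i ^+ e : S) := whomogXn (hX i).
Arguments hXn : clear implicits.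

Let hM : pgraded w (k%:Z * (wz - wx)) (wx - wz) (modulus n u).
Proof.
apply: pgradedD; last exact/pgradedN/pgradedC.
by apply: pgraded_eq (@pgradedXn _ _ _ _ _) _; lia.
Qed.

(** Here [hw] balances the quadric, [hu] balances y^(k+1) with u x^(k+1) in the f_j, and [hu2]
    balances z^k with u^2 x^k in the g_i. *)
Lemma graded1 D v : hrow w shift1 D v -> whomog w D (eval1 n x y z t u (unpack1 v)).
Proof.
move=> hv; have hl := hrow_lsubmx hv.
have hll := hrow_lsubmx hl; have ha := hll 0.
have hA := pgraded_rVpoly (hrow_rsubmx hl).
have hB := pgraded_rVpoly (hrow_rsubmx hv).
rewrite /eval1 /unpack1 /=.
apply: whomogD; first apply: whomogD.
- have hq : whomog w (wx + wt) (quad x y z t).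
    apply: whomogD; first exact: whomogM.
    by rewrite hw; apply/whomogN/whomogM.
  by apply: whomog_eq (whomogM ha hq) _; lia.
- apply: whomogD.
    have h := whomog_heval (i := k) hA (hX iz) (hX it) ltac:(lia).
    by apply: whomog_eq h _; lia.
  apply: whomogN.
  have h := whomog_heval (i := k) hA (hX ix) (hX iy) ltac:(lia).
  by apply: whomog_eq (whomogM hu2 h) _; lia.
- apply: whomogD.
    have h := whomog_heval (i := n) hB (hX it) (hX iy) ltac:(lia).
    by apply: whomog_eq (whomogM (hXn iy 2) h) _; lia.
  apply: whomogN.
  have h := whomog_heval (i := n) hB (hX iz) (hX ix) ltac:(lia).
  by apply: whomog_eq (whomogM (whomogM hu (hXn ix 2)) h) _; lia.
Qed.

Lemma graded2 D v : hrow w shift2 D v -> hrow w shift1 D (diff2 x y z t u v).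
Proof.
move=> hv; have hl := hrow_lsubmx hv; have hr := hrow_rsubmx hv.
have hC' := pgraded_rVpoly (hrow_lsubmx hl).
have hE' := pgraded_rVpoly (hrow_rsubmx hl).
have hC := pgraded_rVpoly (hrow_lsubmx hr).
have hE := pgraded_rVpoly (hrow_rsubmx hr).
rewrite /diff2 /unpack2 /pack1 /eval2 /=.
set C' := rVpoly _ in hC' *; set E' := rVpoly _ in hE' *.
set C := rVpoly _ in hC *; set E := rVpoly _ in hE *.
have hL : whomog w (D - n.+2%:Z * wy - k%:Z * (wz - wx)) (lead2 n x y C E).
  apply: whomogD.
    by apply: whomog_eq (whomogM (hX ix) (hC n)) _; lia.
  by apply: whomog_eq (whomogM (hX iy) (hE n)) _; lia.
apply: hrow_row_mx; first apply: hrow_row_mx.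
- move=> j; rewrite mxE !ord1 eqxx mulr1n.
  apply: whomogD; first apply: whomogD; first apply: whomogD.
  + apply: whomogN.
    have h := whomog_heval (i := n) hC' (hX iz) (hX it) ltac:(lia).
    by apply: whomog_eq h _; lia.
  + apply: whomogN.
    have h := whomog_heval (i := n) hE' (hX ix) (hX iy) ltac:(lia).
    by apply: whomog_eq (whomogM hu2 h) _; lia.
  + have h := whomog_heval (i := n) hC (hX it) (hX iy) ltac:(lia).
    by apply: whomog_eq (whomogM (hX iy) h) _; lia.
  + have h := whomog_heval (i := n) hE (hX iz) (hX ix) ltac:(lia).
    by apply: whomog_eq (whomogM (whomogM hu (hX ix)) h) _; lia.
- apply: hrow_poly_rV; apply: pgradedD; first apply: pgradedD.
  + have h := pgraded_lin (e := wt - wz) (hX ix) (hX iy) ltac:(lia).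
    by apply: pgraded_eq (pgradedM hC' h) _; lia.
  + have h := pgraded_lin (e := wt - wz) (hX iz) (hX it) ltac:(lia).
    by apply: pgraded_eq (pgradedM hE' h) _; lia.
  + have h : pgraded w wy (wt - wz) (y%:P - (u * x) *: 'X^k).
      apply: pgradedD; first exact/pgradedC.
      apply: pgradedN.
      by apply: pgraded_eq (pgradedZ (whomogM hu (hX ix)) (@pgradedXn _ _ _ _ _)) _; lia.
    by apply: pgradedN; apply: pgraded_eq (pgradedZ hL h) _; lia.
- apply: hrow_poly_rV; apply: pgradedD; first apply: pgradedD.
  + have h := pgraded_lin (e := wx - wz) (hX iz) (hX ix) ltac:(lia).
    by apply: pgraded_eq (pgradedM hC h) _; lia.
  + have h := pgraded_lin (e := wx - wz) (hX it) (hX iy) ltac:(lia).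
    by apply: pgraded_eq (pgradedM hE h) _; lia.
  + by apply: pgraded_eq (pgradedZ hL hM) _; lia.
Qed.

Lemma graded3 D v : hrow w shift3 D v -> hrow w shift2 D (diff3 x y z t u v).
Proof.
move=> hv; have hD' := pgraded_rVpoly (hrow_lsubmx hv).
have hD := pgraded_rVpoly (hrow_rsubmx hv).
rewrite /diff3 /unpack3 /pack2 /eval3 /=.
set D' := rVpoly _ in hD' *; set F := rVpoly _ in hD *.
have hl := hD n.
apply: hrow_row_mx; apply: hrow_row_mx; apply: hrow_poly_rV.
- apply: pgradedD.
    have h := pgraded_lin (e := wt - wz) (hX iz) (hX it) ltac:(lia).
    by apply: pgraded_eq (pgradedM hD' h) _; lia.
  have h : pgraded w (wy + wt) (wt - wz) ((y * t)%:P - (u * x * z) *: 'X^n).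
    apply: pgradedD; first exact/pgradedC/whomogM.
    apply: pgradedN.
    by apply: pgraded_eq (pgradedZ (whomogM (whomogM hu (hX ix)) (hX iz))
      (@pgradedXn _ _ _ _ _)) _; lia.
  by apply: pgraded_eq (pgradedZ hl h) _; lia.
- apply: pgradedN; apply: pgradedD.
    have h := pgraded_lin (e := wt - wz) (hX ix) (hX iy) ltac:(lia).
    by apply: pgraded_eq (pgradedM hD' h) _; lia.
  have h : pgraded w (2%:Z * wy) (wt - wz) ((y ^+ 2)%:P - (u * x ^+ 2) *: 'X^n).
    apply: pgradedD; first exact/pgradedC/hXn.
    apply: pgradedN.
    by apply: pgraded_eq (pgradedZ (whomogM hu (hXn ix 2)) (@pgradedXn _ _ _ _ _)) _; lia.
  by apply: pgraded_eq (pgradedZ hl h) _; lia.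
- apply: pgradedD.
    have h := pgraded_lin (e := wx - wz) (hX it) (hX iy) ltac:(lia).
    by apply: pgraded_eq (pgradedM hD h) _; lia.
  by apply: pgraded_eq (pgradedZ (whomogM (hX iy) hl) hM) _; lia.
- apply: pgradedN; apply: pgradedD.
    have h := pgraded_lin (e := wx - wz) (hX iz) (hX ix) ltac:(lia).
    by apply: pgraded_eq (pgradedM hD h) _; lia.
  by apply: pgraded_eq (pgradedZ (whomogM (hX ix) hl) hM) _; lia.
Qed.

End GradedDifferentials.

Section MinimalDifferentials.
Variables (K : fieldType) (n : nat) (u : {mpoly K[4]}).
Local Notation k := n.+1.
Local Notation S := {mpoly K[4]}.
Local Notation x := ('X_ix : S).
Local Notation y := ('X_iy : S).
Local Notation z := ('X_iz : S).
Local Notation t := ('X_it : S).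

Hypothesis hu : nconst u.
Hypothesis n0 : (0 < n)%N.

Let hX i : nconst ('X_i : S) := @nconstX _ K i.
Arguments hX : clear implicits.

Lemma nconst_eval1 (v : S^o * {poly S} * {poly S}) : nconst (eval1 n x y z t u v).
Proof.
rewrite /eval1; apply: nconstD; first apply: nconstD.
- by apply: nconstMr; apply: nconstD; [apply: nconstM|apply/nconstN/nconstM].
- apply: nconstD; first exact: nconst_heval.
  by apply/nconstN; rewrite expr2 -mulrA; apply: nconstM.
- apply: nconstD; first by rewrite expr2 -mulrA; apply: nconstM.
  by apply/nconstN; rewrite -mulrA; apply: nconstM.
Qed.

Let nconst_row_mx p q (v1 : 'rV[S]_p) (v2 : 'rV[S]_q) :
  (forall i, nconst (v1 0 i)) -> (forall i, nconst (v2 0 i)) ->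
  forall i, nconst (row_mx v1 v2 0 i).
Proof. by move=> h1 h2 i; rewrite mxE; case: (split i). Qed.

Let nconst_poly_rV p P : pnconst P -> forall i : 'I_p, nconst (poly_rV P 0 i : S).
Proof. by move=> hP i; rewrite mxE; apply: hP. Qed.

Let pnconst_linX (a c : 'I_4) : pnconst (('X_a : S)%:P - ('X_c : S) *: 'X).
Proof. by rewrite -['X]expr1; apply: pnconst_lin. Qed.

Lemma nconst_diff2 (v : 'rV_(k + k + (k + k))) j : nconst (diff2 x y z t u v 0 j).
Proof.
(* Positivity of n matters: in degree 0 the evaluation is a bare coefficient of P, possibly a
   unit. *)
have hH (p q : S) P : nconst p -> nconst q -> nconst (heval n p q P).
  by rewrite -(prednK n0); apply: nconst_heval.
apply: nconst_row_mx => {j}; first apply: nconst_row_mx.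
- move=> j; rewrite mxE !ord1 eqxx mulr1n /=.
  apply: nconstD; [apply: nconstD; [apply: nconstD|]|].
  + exact/nconstN/hH.
  + exact/nconstN/nconstMr/hH.
  + exact/nconstM.
  + exact/nconstMr/hH.
- apply: nconst_poly_rV; apply: pnconstD; [apply: pnconstD; exact: pnconstM|].
  by apply/pnconstN/pnconstZr/pnconst_lin => //; apply: nconstM.
- apply: nconst_poly_rV; apply: pnconstD; [apply: pnconstD; exact: pnconstM|].
  by apply: pnconstZ; apply: nconstD; apply: nconstM.
Qed.

Lemma nconst_diff3 (v : 'rV_(n + k)) j : nconst (diff3 x y z t u v 0 j).
Proof.
apply: nconst_row_mx => {j}; apply: nconst_row_mx; apply: nconst_poly_rV.
- apply: pnconstD; first exact: pnconstM.
  apply: pnconstZr; apply: pnconst_lin; first exact: nconstM.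
  by rewrite -mulrA; apply: nconstM.
- apply: pnconstN; apply: pnconstD; first exact: pnconstM.
  apply: pnconstZr; apply: pnconst_lin.
    by rewrite expr2; apply: nconstM.
  exact: nconstM.
- by apply: pnconstD; [exact: pnconstM|apply: pnconstZ; apply: nconstM].
- apply: pnconstN; apply: pnconstD; first exact: pnconstM.
  by apply: pnconstZ; apply: nconstM.
Qed.

End MinimalDifferentials.

(** * The resolution and its Betti numbers *)

Section Resolution.
Variables (K : fieldType) (n : nat) (c : K) (w : 'I_4 -> nat).
Variable I : {mpoly K[4]} -> Prop.
Local Notation k := n.+1.
Local Notation S := {mpoly K[4]}.
Local Notation x := ('X_ix : S).
Local Notation y := ('X_iy : S).
Local Notation z := ('X_iz : S).
Local Notation t := ('X_it : S).
Local Notation u := (c%:MP * 'X_ix : S).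

Hypothesis hw : (w ix)%:Z + (w it)%:Z = (w iy)%:Z + (w iz)%:Z.
Hypothesis hu : whomog w (n.+2%:Z * ((w iy)%:Z - (w ix)%:Z)) u.
Hypothesis hu2 : whomog w (k%:Z * ((w iz)%:Z - (w ix)%:Z)) (u ^+ 2).
Hypothesis n0 : (0 < n)%N.
Hypothesis I_eideal : forall f, I f <-> eideal n x y z t u f.

Definition res_rank (i : nat) : nat :=
  match i with
  | 0 => 1
  | 1 => 1 + k.+1 + k
  | 2 => k + k + (k + k)
  | 3 => n + k
  | _ => 0
  end.

Definition res_diff (i : nat) : 'M[S]_(res_rank i.+1, res_rank i) :=
  match i return 'M[S]_(res_rank i.+1, res_rank i) with
  | 0 => D1 n c
  | 1 => D2 n c
  | 2 => D3 n c
  | _ => 0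
  end.

Definition res_shift (i : nat) : 'I_(res_rank i) -> int :=
  match i return 'I_(res_rank i) -> int with
  | 1 => @shift1 n w
  | 2 => @shift2 n w
  | 3 => @shift3 n w
  | _ => fun=> 0
  end.

Let nconst_u : nconst u := nconstMr _ (nconstX _ _).

Lemma lin1_mxE m p (f : 'rV[S]_m -> 'rV[S]_p) i j :
  lin1_mx f i j = f (delta_mx 0 i) 0 j.
Proof. by rewrite mxE. Qed.

Lemma res_aug_surjective : exists v : 'rV[S]_1, I ((v *m 1%:M) 0 0 - 1).
Proof.
by exists 1%:M; rewrite mulmx1 mxE subrr; apply/I_eideal/eideal0.
Qed.

Lemma res_aug_exact (v : 'rV[S]_1) :
  I ((v *m 1%:M) 0 0) <-> exists v' : 'rV_(1 + k.+1 + k), v = v' *m D1 n c.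
Proof.
rewrite mulmx1; split=> [/I_eideal[e [se De]]|[v' ->]].
  exists (pack1 n e); rewrite mul_diff_mx1 /diff1 pack1K // -De.
  by apply/rowP => i; rewrite !ord1 mxE eqxx.
apply/I_eideal; rewrite mul_diff_mx1 /diff1 mxE eqxx mulr1n.
by exists (unpack1 v'); split; first exact: short_unpack1.
Qed.

Lemma res_diff_exact i (v : 'rV[S]_(res_rank i.+1)) :
  v *m res_diff i = 0 <-> exists v', v = v' *m res_diff i.+1.
Proof.
case: i v => [|[|[|i]]] v.
- exact: exact_D1.
- exact: exact_D2.
- split=> [/exact_D3->|[v' ->]]; first by exists 0; rewrite mul0mx.
  by rewrite /= mulmx0 mul0mx.
- by split=> [_|_]; [exists 0; rewrite mul0mx; exact: thinmx0 | exact: mulmx0].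
Qed.

Lemma res_diff_graded i j l m : m \in msupp (res_diff i j l) ->
  (\sum_a m a * w a)%N%:Z + res_shift l = res_shift j.
Proof.
have Q (D s : int) f : whomog w (D - s) f -> m \in msupp f ->
    (\sum_a m a * w a)%N%:Z + s = D.
  by move=> hf /hf->; rewrite subrK.
case: i j l => [|[|[|i]]] j l.
- apply: Q; rewrite subr0 /= lin1_mxE ord1 mxE eqxx mulr1n.
  exact: (graded1 hw hu hu2 (@hrow_delta _ _ w _ (@shift1 n w) j)).
- apply: Q; rewrite /= lin1_mxE.
  exact: (graded2 hw hu hu2 (@hrow_delta _ _ w _ (@shift2 n w) j)).
- apply: Q; rewrite /= lin1_mxE.
  exact: (graded3 hw hu hu2 (@hrow_delta _ _ w _ (@shift3 n w) j)).
- by rewrite /= mxE msupp0.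
Qed.

Lemma res_diff_minimal i j l : (res_diff i j l)@_0 = 0.
Proof.
case: i j l => [|[|[|i]]] j l.
- by rewrite /= lin1_mxE ord1 mxE eqxx mulr1n; apply: nconst_eval1.
- by rewrite /= lin1_mxE; apply: nconst_diff2.
- by rewrite /= lin1_mxE; apply: nconst_diff3.
- by rewrite /= mxE mcoeff0.
Qed.

Lemma res_aug_graded j m : m \in msupp ((1%:M : 'cV[S]_1) j 0) ->
  (\sum_l m l * w l)%N%:Z = res_shift (i := 0) j.
Proof.
rewrite !ord1 mxE eqxx mulr1n -mpolyC1 => /whomogC -> //.
Qed.

Definition resolution : minimal_graded_resolution w I :=
  @MGR 4 K w I res_rank 1%:M res_diff res_shift res_aug_surjective res_aug_exact
    res_diff_exact res_aug_graded res_diff_graded res_diff_minimal.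

Lemma betti_resolution (s : seq nat) : last 0%N s != 0%N ->
  (forall i, res_rank i = nth 0%N s i) -> has_betti_sequence w I s.
Proof. by move=> s0 rs; split=> //; exists resolution. Qed.

End Resolution.

Lemma Bgen_val h n : (2 <= h)%N -> n.+1 = (2 * h - 1)%N ->
  [/\ tnth (Bgen h) ix = (n.+1 * n.+2)%N, tnth (Bgen h) iy = (n.+1 * n.+3)%N,
      tnth (Bgen h) iz = (n.+2 * n.+3)%N
    & tnth (Bgen h) it = (n.+2 * n.+3 + n.+1)%N].
Proof.
move=> hh Dn; have e1 : (2 * h = n.+2)%N by lia.
have e2 : (2 * h + 1 = n.+3)%N by lia.
rewrite !(tnth_nth 0%N) /= -Dn -addnBA -?Dn; last by lia.
by rewrite e2 e1.
Qed.

Theorem theorem8p1 (K : fieldType) (h : nat) (hh : (2 <= h)%N) :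
  has_betti_sequence (tnth (Bgen h))
    (toric_ideal K (tnth (Bgen h)))
    [:: 1%N; (4 * h)%N; (8 * h - 4)%N; (4 * h - 3)%N]
  /\
  has_betti_sequence (fun _ : 'I_4 => 1%N)
    (tangent_cone_ideal (toric_ideal K (tnth (Bgen h))))
    [:: 1%N; (4 * h)%N; (8 * h - 4)%N; (4 * h - 3)%N].
Proof.
pose n := (2 * h - 2)%N.
have Dn : n.+1 = (2 * h - 1)%N by rewrite /n; lia.
have n0 : (0 < n)%N by rewrite /n; lia.
have odd_k : odd n.+1 by rewrite Dn; lia.
have b_val := Bgen_val hh Dn; have [bx by_ bz bt] := b_val.
have rs i : res_rank n i
    = nth 0%N [:: 1%N; (4 * h)%N; (8 * h - 4)%N; (4 * h - 3)%N] i.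
  by case: i => [|[|[|[|i]]]]; rewrite /= ?nth_nil //; lia.
have s0 : last 0%N [:: 1%N; (4 * h)%N; (8 * h - 4)%N; (4 * h - 3)%N] != 0%N.
  by rewrite /=; lia.
have hX1 : whomog (tnth (Bgen h)) (tnth (Bgen h) ix)%:Z (1%:MP * 'X_ix : {mpoly K[4]}).
  by rewrite mpolyC1 mul1r; apply: whomogX.
split.
- apply: (@betti_resolution K n 1) s0 rs => //.
  + by rewrite bx by_ bz bt; lia.
  (* The second and first semigroup generators differ by k, so the required weight (k+1) k is that
     of x; likewise the third and first differ by 2 (k+1), which gives x^2 the weight k times
     this. *)
  + by apply: whomog_eq hX1 _; rewrite bx by_; lia.
  + by apply: whomog_eq (whomogXn hX1) _; rewrite bx bz; lia.
  + rewrite mpolyC1 mul1r => f; split; first exact: (toric_eideal odd_k b_val).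
    exact: (eideal_toric odd_k b_val).
- apply: (@betti_resolution K n 0) s0 rs => //.
  (* For c = 0 the degree conditions hold since 0 is homogeneous of every degree. *)
  + by rewrite mpolyC0 mul0r; apply: whomog0.
  + by rewrite mpolyC0 mul0r expr0n; apply: whomog0.
  + by rewrite mpolyC0 mul0r; apply: (tangent_eideal odd_k b_val).
Qed.
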